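(* Consider the problem of describing the maximizers of the classical entropy $\mathcal{H}_{cl}$ over nonnegative measures $\lambda$ on $\mathbb{T}^d$ subject to the constraints $\mathcal{M}(\lambda)=\mathcal{M}_0$ and $\mathcal{E}(\lambda)=\mathcal{E}_0$. (i) If $\alpha<\frac{\mathcal{E}_0}{\mathcal{M}_0}<\beta$, the unique maximizer is the unique Rayleigh-Jeans equilibrium with this mass and energy. (ii) If $\beta\le\frac{\mathcal{E}_0}{\mathcal{M}_0}<1$, maximizers are of the type $R_{\mu,\nu}+\lambda_{\mathrm{sing}}$, where $(\mu,\nu)$ are characterized by $$\mathcal{M}(R_{\mu,\nu})=\frac{\mathcal{M}_0-\mathcal{E}_0}{1-\beta},\qquad \mathcal{E}(R_{\mu,\nu})=\beta\,\frac{\mathcal{M}_0-\mathcal{E}_0}{1-\beta},$$ and $\lambda_{\mathrm{sing}}$ has mass $\frac{1}{1-\beta}(\mathcal{E}_0-\beta\mathcal{M}_0)$ and is supported on the set where $\omega$ is maximal. (iii) If $a<\frac{\mathcal{E}_0}{\mathcal{M}_0}\le\alpha$, maximizers are of the type $R_{\mu,\nu}+\lambda_{\mathrm{sing}}$ with $$\mathcal{M}(R_{\mu,\nu})=\frac{\mathcal{M}_0-\mathcal{E}_0}{1-\alpha},\qquad \mathcal{E}(R_{\mu,\nu})=\alpha\,\frac{\mathcal{M}_0-\mathcal{E}_0}{1-\alpha}.$$ Also, $\lambda_{\mathrm{sing}}$ has mass and energy equal to $\frac{1}{1-\alpha}(\mathcal{E}_0-\alpha\mathcal{M}_0)$ and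 is supported on the set where $\omega$ is maximal.
   Context: $\mathbb{T}^d=\mathbb{R}^d/(2\pi\mathbb{Z})^d$, with Lebesgue measure $dp$ (total mass $(2\pi)^d$). The dispersion relation $\omega:\mathbb{T}^d\to[0,\infty)$ is a fixed continuous function with $\min\omega=a\ge 0$ and $\max\omega=1$, taking its maximal and minimal values on sets of Lebesgue measure zero. A nonnegative measure $\lambda$ on $\mathbb{T}^d$ is decomposed as $d\lambda=f\,dp+d\lambda_{\mathrm{sing}}$, into a part absolutely continuous with respect to Lebesgue measure and a singular part. Mass, energy and classical entropy are $$\mathcal{M}(\lambda)=\int_{\mathbb{T}^d}d\lambda,\qquad \mathcal{E}(\lambda)=\int_{\mathbb{T}^d}\omega\,d\lambda,\qquad \mathcal{H}_{cl}(\lambda)=\int_{\mathbb{T}^d}\ln f(p)\,dp,$$ so the entropy only sees the absolutely continuous part. A nonnegative function $g$ is identified with the measure $g\,dp$, and $\mathcal{M}(g)$, $\mathcal{E}(g)$ denote its mass and energy. A Rayleigh-Jeans equilibrium is a function $R_{\mu,\nu}(p)=\frac{1}{\mu\omega(p)+\nu}$ with real $(\mu,\nu)\ne(0,0)$ such that $\mu\omega+\nu\ge 0$ on $\mathbb{T}^d$. The thresholds are $$\alpha=a+(2\pi)^d\Big(\int_{\mathbb{T}^d}\frac{dp}{\omega-a}\Big)^{-1},\qquad \beta=1-(2\pi)^d\Big(\int_{\mathbb{T}^d}\frac{dp}{1-\omega}\Big)^{-1},$$ with the convention $\infty^{-1}=0$; one has $a\le\alpha<\beta\le1$.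
   Formalization: Part (iii) as printed gives negative singular mass when E0/M0<α; corrected to M(R)=(E0−aM0)/(α−a), E(R)=α·M(R), with λ_sing of mass (αM0−E0)/(α−a) and energy a times that mass, supported where ω is minimal (ω=a). *)

(* Defs.v *)
From HB Require Import structures.
From mathcomp Require Import all_boot all_order all_algebra generic_quotient.
From mathcomp Require Import all_classical all_reals all_analysis.
From mathcomp Require Import measurable_realfun.

Set Implicit Arguments.
Unset Strict Implicit.
Unset Printing Implicit Defensive.
Import Order.TTheory GRing.Theory Num.Theory.
Import numFieldNormedType.Exports.
Local Open Scope classical_set_scope.
Local Open Scope ring_scope.

Section Torus.
Context {R : realType} (d : nat).

Definition torus_rel (x y : 'rV[R]_d) : bool :=
  `[< exists k : 'rV[int]_d, x - y = (2 * pi) *: map_mx intr k >].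

Lemma torus_rel_refl : reflexive torus_rel.
Proof. by move=> x; apply/asboolP; exists 0; rewrite subrr map_mx0 scaler0. Qed.

Lemma torus_rel_sym : symmetric torus_rel.
Proof.
have H x y : torus_rel x y -> torus_rel y x.
  move=> /asboolP[k e]; apply/asboolP; exists (- k).
  by rewrite map_mxN scalerN -e opprB.
by move=> x y; apply/idP/idP; apply: H.
Qed.

Lemma torus_rel_trans : transitive torus_rel.
Proof.
move=> y x z /asboolP[k ek] /asboolP[l el]; apply/asboolP; exists (k + l).
by rewrite map_mxD scalerDr -ek -el addrA subrK.
Qed.

Canonical torus_equiv :=
  EquivRel torus_rel torus_rel_refl torus_rel_sym torus_rel_trans.

End Torus.

Definition torus (R : realType) (d : nat) : Type :=
  quotient_topology {eq_quot (@torus_equiv R d)}%qT.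

HB.instance Definition _ R d := Topological.on (torus R d).
HB.instance Definition _ R d := Quotient.on (torus R d).
HB.instance Definition _ R d := isPointed.Build (torus R d) (\pi_(torus R d) 0)%qT.

(* Borel sigma-algebra *)
Section TorusBorel.
Context (R : realType) (d : nat).
Let G : set (set (torus R d)) := open.

HB.instance Definition _ := @isMeasurable.Build (sigma_display G)
  (torus R d) <<s G >> (@sigma_algebra0 _ setT G) (@sigma_algebraC _ G)
  (@sigma_algebra_bigcup _ setT G).

End TorusBorel.

Section TorusLebesgue.
Context {R : realType}.
Local Open Scope ereal_scope.
Local Notation BR := (measurableTypeR R).

Definition tuple_proj d (t : d.-tuple BR) : torus R d :=
  (\pi_(torus R d) (\row_i tnth t i))%qT.

Lemma open_tuple_measurable d (U : set 'rV[R]_d) : open U ->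
  measurable [set t : d.-tuple BR | U (\row_i tnth t i)].
Proof.
move=> oU.
pose box (q : {ffun 'I_d -> rat * rat}) : set (d.-tuple BR) :=
  \bigcap_(i in [set: 'I_d])
    [set t | tnth t i \in `](ratr (q i).1 : R), (ratr (q i).2 : R)[].
have mbox q : measurable (box q).
  apply: fin_bigcap_measurable => // i _.
  rewrite -[X in measurable X]setTI.
  by apply: (@measurable_tnth _ BR d i measurableT _ (measurable_itv _)).
pose Q := [set q | box q `<=` [set t : d.-tuple BR | U (\row_i tnth t i)]].
rewrite (_ : [set t : d.-tuple BR | _] =
  \bigcup_(n in [set n | if unpickle n is Some q then Q q else False])
    (if unpickle n is Some q then box q else set0)).
  by apply: bigcup_measurable => n _; case: unpickle.
apply/seteqP; split=> [t Ut|t [n /=]]; last first.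
  by case: unpickle => // q; exact.
have : nbhs (\row_i tnth t i : 'rV[R]_d) U by exact: open_nbhs_nbhs.
move=> /nbhs_ballP[e /= e0 eU].
have H (i : 'I_d) : exists q : rat * rat,
   [/\ (tnth t i - e < ratr q.1)%R, (ratr q.1 < tnth t i)%R,
       (tnth t i < ratr q.2)%R & (ratr q.2 < tnth t i + e)%R].
  have /rat_in_itvoo[q1] : (tnth t i - e < tnth t i)%R by rewrite ltrBlDr ltrDl.
  have /rat_in_itvoo[q2] : (tnth t i < tnth t i + e)%R by rewrite ltrDl.
  rewrite !inE /= => /andP[? ?] /andP[? ?].
  by exists (q1, q2).
pose q : {ffun 'I_d -> rat * rat} := [ffun i => sval (cid (H i))].
have qE i : q i = sval (cid (H i)) by rewrite ffunE.
exists (pickle q); rewrite /= pickleK.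
  move=> s sq; apply: eU; split=> // i j; rewrite !mxE.
  have := sq j I; rewrite /= in_itv /= qE; case: cid => -[q1 q2] /= [a b c f].
  rewrite /ball/= => /andP[u v]; rewrite ltr_distlC.
  by rewrite (lt_trans a u) (lt_trans v f).
move=> j _; rewrite /= qE; case: cid => -[q1 q2] /= [a b c f].
by apply/andP; split.
Qed.

Local Lemma measurable_tuple_proj d : measurable_fun setT (@tuple_proj d).
Proof.
apply: (@measurability _ _ _ (torus R d) setT (@tuple_proj d) open erefl).
move=> _ [U oU <-]; rewrite setTI.
exact: (@open_tuple_measurable d (\pi_(torus R d) @^-1` U)%qT oU).
Qed.

HB.instance Definition _ d := isMeasurableFun.Build _ _ _ _
  (@tuple_proj d) (@measurable_tuple_proj d).

Local Definition itv_0_2pi : set BR := `[0%R, (2 * pi)%R[%classic.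

Local Lemma measurable_itv_0_2pi : measurable itv_0_2pi.
Proof. exact: measurable_itv. Qed.

Local Lemma lebesgue_itv_lty : @lebesgue_measure R itv_0_2pi < +oo.
Proof. by rewrite /itv_0_2pi lebesgue_measure_itv/=; case: ifP => _; rewrite ltry. Qed.

(* Lebesgue measure on the line, restricted to [0, 2 pi[ *)
Definition lebesgue_0_2pi : {finite_measure set BR -> \bar R} :=
  mfrestr measurable_itv_0_2pi lebesgue_itv_lty.

Lemma lebesgue_0_2piT : lebesgue_0_2pi setT = (2 * pi)%:E.
Proof.
rewrite /lebesgue_0_2pi/= /mfrestr /mrestr setTI /itv_0_2pi lebesgue_measure_itv/= lte_fin.
by rewrite mulr_gt0 ?pi_gt0// sube0.
Qed.

Definition tuple_cons n (xt : BR * n.-tuple BR) : n.+1.-tuple BR :=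
  [the n.+1.-tuple BR of xt.1 :: xt.2].

Local Lemma measurable_tuple_cons n : measurable_fun setT (@tuple_cons n).
Proof. exact: measurable_cons. Qed.

HB.instance Definition _ n := isMeasurableFun.Build _ _ _ _
  (@tuple_cons n) (@measurable_tuple_cons n).

Section CubeStep.
Variables (n : nat) (mu : {finite_measure set (n.-tuple BR) -> \bar R}).

Definition cube_step : set (n.+1.-tuple BR) -> \bar R :=
  pushforward (lebesgue_0_2pi \x mu) (@tuple_cons n).

Local Lemma cube_step0 : cube_step set0 = 0.
Proof. by rewrite /cube_step /pushforward preimage_set0 measure0. Qed.

Local Lemma cube_step_ge0 A : 0 <= cube_step A.
Proof. exact: measure_ge0. Qed.

Local Lemma cube_step_sigma : semi_sigma_additive cube_step.
Proof. exact: measure_semi_sigma_additive. Qed.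

HB.instance Definition _ := isMeasure.Build _ _ _ cube_step
  cube_step0 cube_step_ge0 cube_step_sigma.

Lemma cube_stepT : cube_step setT = (2 * pi)%:E * mu setT.
Proof.
rewrite /cube_step /pushforward preimage_setT -setXTT product_measure1E//.
by rewrite [X in X * _]lebesgue_0_2piT.
Qed.

Local Lemma cube_step_fin : fin_num_fun cube_step.
Proof.
move=> A mA; rewrite ge0_fin_numE//.
apply: (@le_lt_trans _ _ (cube_step setT)).
  by apply: le_measure; rewrite ?inE.
rewrite cube_stepT -ge0_fin_numE ?fin_numM ?fin_num_measure//.
by rewrite mule_ge0// lee_fin mulr_ge0// pi_ge0.
Qed.

HB.instance Definition _ := Measure_isFinite.Build _ _ _ cube_step
  cube_step_fin.

End CubeStep.

(* n-fold product of [lebesgue_0_2pi], i.e. Lebesgue measure on [0, 2 pi[^n *)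
Fixpoint cube_lebesgue n : {finite_measure set (n.-tuple BR) -> \bar R} :=
  match n with
  | 0 => (\d_([tuple of [::]] : 0.-tuple BR) : {finite_measure set _ -> \bar R})
  | m.+1 => (cube_step (cube_lebesgue m) : {finite_measure set _ -> \bar R})
  end.

(* The cube [0, 2 pi[^d is a fundamental domain, so this is the measure induced
   on the quotient by d-dimensional Lebesgue measure. *)
Definition torus_lebesgue d : set (torus R d) -> \bar R :=
  pushforward (cube_lebesgue d) (@tuple_proj d).

Local Lemma torus_lebesgue0 d : @torus_lebesgue d set0 = 0.
Proof. exact: measure0. Qed.

Local Lemma torus_lebesgue_ge0 d A : 0 <= @torus_lebesgue d A.
Proof. exact: measure_ge0. Qed.

Local Lemma torus_lebesgue_sigma d : semi_sigma_additive (@torus_lebesgue d).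
Proof. exact: measure_semi_sigma_additive. Qed.

HB.instance Definition _ d := isMeasure.Build _ _ _ (@torus_lebesgue d)
  (torus_lebesgue0 d) (@torus_lebesgue_ge0 d) (@torus_lebesgue_sigma d).

Lemma torus_lebesgueT d : @torus_lebesgue d setT = ((2 * pi) ^+ d)%:E.
Proof.
rewrite /torus_lebesgue /pushforward preimage_setT; elim: d => [|d IH].
  by rewrite /= diracT expr0.
by rewrite /= cube_stepT IH exprS.
Qed.

Local Lemma torus_lebesgue_fin d : fin_num_fun (@torus_lebesgue d).
Proof.
move=> A mA; rewrite ge0_fin_numE//.
apply: (@le_lt_trans _ _ (torus_lebesgue setT)).
  by apply: le_measure; rewrite ?inE.
by rewrite torus_lebesgueT ltry.
Qed.

HB.instance Definition _ d := Measure_isFinite.Build _ _ _ (@torus_lebesgue d)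
  (@torus_lebesgue_fin d).

End TorusLebesgue.
Arguments torus_lebesgue {R d}.

Section Entropy.
Context {R : realType} {d : nat}.
Local Open Scope ereal_scope.
Local Notation T := (torus R d).
Local Notation dp := (@torus_lebesgue R d).
Implicit Types (lam sing : {measure set T -> \bar R}) (f g : T -> \bar R).
Implicit Types (omega : T -> R) (munu : R * R).

Definition singular sing : Prop :=
  exists N : set T, [/\ measurable N, dp N = 0 & sing (~` N) = 0].

(* d(lam) = f dp + d(sing) *)
Definition lebesgue_decomposition lam f sing : Prop :=
  [/\ measurable_fun [set: T] f, (forall p, 0 <= f p), singular sing &
      forall A, measurable A -> lam A = \int[dp]_(p in A) f p + sing A].

Definition has_density lam g : Prop :=
  forall A, measurable A -> lam A = \int[dp]_(p in A) g p.

(* For finite lam the density exists and is unique up to dp-negligible sets,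
   so [entropy] does not depend on the choice made here. *)
Definition ac_density lam : T -> \bar R :=
  xget (cst 0) [set f | exists sing, lebesgue_decomposition lam f sing].

Definition mass lam : \bar R := lam [set: T].

Definition energy omega lam : \bar R := \int[lam]_p (omega p)%:E.

(* [lne] is used because [lne 0 = -oo], whereas [ln 0 = 0].  For lam of finite
   mass the positive part is integrable, so the integral is in [-oo, +oo[. *)
Definition entropy lam : \bar R := \int[dp]_p lne (ac_density lam p).

Definition density_mass g : \bar R := \int[dp]_p g p.

Definition density_energy omega g : \bar R := \int[dp]_p ((omega p)%:E * g p).

Definition supported_on sing (S : set T) : Prop := sing (~` S) = 0.

Definition feasible omega (M0 E0 : R) lam : Prop :=
  mass lam = M0%:E /\ energy omega lam = E0%:E.

Definition maximizer omega (M0 E0 : R) lam : Prop :=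
  feasible omega M0 E0 lam /\
  forall lam', feasible omega M0 E0 lam' -> entropy lam' <= entropy lam.

(* The inverse is taken in [\bar R], so the value is +oo at the zeros of
   mu * omega + nu. *)
Definition rayleigh_jeans omega munu (p : T) : \bar R :=
  ((munu.1 * omega p + munu.2)%R%:E)^-1.

Definition rj_admissible omega munu : Prop :=
  munu <> (0%R, 0%R) /\ forall p, (0 <= munu.1 * omega p + munu.2)%R.

Definition rj_with_mass_energy omega (M E : R) munu : Prop :=
  [/\ rj_admissible omega munu,
      density_mass (rayleigh_jeans omega munu) = M%:E &
      density_energy omega (rayleigh_jeans omega munu) = E%:E].

(* Inverses in [\bar R]: 1 / 0 = +oo in the integrand, and 1 / +oo = 0 when the
   integral diverges. *)
Definition alpha omega (a : R) : R :=
  let I : \bar R := \int[dp]_p ((omega p - a)%R%:E)^-1 in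
  (a + (2 * pi) ^+ d * fine (I^-1)%E)%R.

Definition beta omega : R :=
  let I : \bar R := \int[dp]_p ((1 - omega p)%R%:E)^-1 in
  (1 - (2 * pi) ^+ d * fine (I^-1)%E)%R.

End Entropy.

(* Main.v *)
(* For mu w + nu >= 0 with mu E0 + nu M0 = (2 pi)^d, the inequality
   ln x <= x - 1 applied to x = (mu w + nu) f and integrated against dp bounds
   the entropy of every feasible f dp + d(sing) by that of R_{mu,nu}; equality
   forces f = R_{mu,nu} almost everywhere and the singular part to live on the
   zeros of mu w + nu.  The maximizers are therefore known once a suitable
   (mu, nu) is found.  Below alpha and above beta one takes mu w + nu
   proportional to w - a or 1 - w, and the missing mass condenses on the zeros.
   Between the thresholds one takes mu w + nu proportional to
   k_s = 1 + s (w - e) with e = E0 / M0, where s is a zero of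
   F(s) = int (w - e) / k_s dp: since s F(s) = (2 pi)^d - int 1 / k_s dp, the
   conditions alpha < e and e < beta say exactly that F has opposite signs near
   the two ends of the interval on which k_s > 0. *)
Require Import Defs.
From HB Require Import structures.
From mathcomp Require Import all_boot all_order all_algebra generic_quotient.
From mathcomp Require Import all_classical all_reals all_analysis.
From mathcomp Require Import measurable_realfun.
From mathcomp Require Import ring lra.

Set Implicit Arguments.
Unset Strict Implicit.
Unset Printing Implicit Defensive.
Import Order.TTheory GRing.Theory Num.Theory.
Import numFieldNormedType.Exports.
Local Open Scope classical_set_scope.
Local Open Scope ring_scope.

(** * Integration against a measure with a density *)

Section Density.
Local Open Scope ereal_scope.
Context {disp : measure_display} {T : measurableType disp} {R : realType}.
Variable m : {measure set T -> \bar R}.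
Implicit Types f g : T -> \bar R.

Import HBNNSimple.

(** By linearity the formula passes from indicators to simple functions, and by monotone convergence
    to [g]. *)
Lemma ge0_integral_density (nu : {measure set T -> \bar R}) f :
  measurable_fun setT f -> (forall x, 0 <= f x) ->
  (forall A, measurable A -> nu A = \int[m]_(x in A) f x) ->
  forall g, measurable_fun setT g -> (forall x, 0 <= g x) ->
  \int[nu]_x g x = \int[m]_x (g x * f x).
Proof.
move=> mf f0 nuE g mg g0.
pose h := nnsfun_approx measurableT mg.
have mh n : measurable_fun setT (EFin \o h n).
  exact/measurable_EFinP.
have hnd x a b : (a <= b)%N -> (h a x)%:E <= (h b x)%:E.
  by move=> ab; rewrite lee_fin; exact/lefP/nd_nnsfun_approx.
have hg x : (EFin \o h n) x @[n --> \oo] --> g x.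
  exact: cvg_nnsfun_approx.
transitivity (limn (fun n => \int[nu]_x (EFin \o h n) x)).
  rewrite -monotone_convergence//=.
  - by apply: eq_integral => x _; apply/esym/cvg_lim => //; exact: hg.
  - by move=> n x _; rewrite lee_fin.
  - by move=> x _ a b ab; exact: hnd.
transitivity (limn (fun n => \int[m]_x ((EFin \o h n) x * f x))); last first.
  rewrite -monotone_convergence//=.
  - apply: eq_integral => x _; apply/cvg_lim => //.
    have [fx|] := boolP (f x \is a fin_num).
      by apply: cvgeZr => //; exact: hg.
    (* Now [f x = +oo], and the product is not continuous at [(0, +oo)]. If [g x = 0], then
       [h n x <= g x] makes every term zero. *)
    rewrite ge0_fin_numE// -leNgt leye_eq => /eqP fx.
    have [gx0|gx0] := eqVneq (g x) 0; last first.
      apply: cvgeM; [|exact: (hg x)|exact: cvg_cst].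
      by rewrite fx /mule_def; case: (g x) gx0.
    rewrite gx0 mul0e (_ : (fun _ => _) = cst 0); first exact: cvg_cst.
    apply/funext => n; suff /= -> : (EFin \o h n) x = 0 by rewrite mul0e.
    apply/eqP; rewrite eq_le; apply/andP; split; last by rewrite lee_fin.
    rewrite -[leRHS]gx0.
    have -> : g x = ereal_sup (range (fun n => (h n x)%:E)).
      apply: cvg_unique (hg x) _ => //.
      exact: ereal_nondecreasing_cvgn (hnd x).
    by apply: ereal_sup_ubound; exists n.
  - by move=> n; apply: emeasurable_funM => //; exact: (mh n).
  - by move=> n x _; rewrite mule_ge0// lee_fin.
  - by move=> x _ a b ab; rewrite lee_wpmul2r//; exact: hnd.
congr (limn _); apply/funext => n.
have indich r : measurable_fun setT (fun x => (r * \1_(h n @^-1` [set r]) x)%:E).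
  by apply: (measurable_comp measurableT) => //; exact: measurable_funM.
have hE x : (EFin \o h n) x =
    \sum_(y \in range (h n)) (y * \1_(h n @^-1` [set y]) x)%:E.
  by rewrite /= fimfunE -fsumEFin.
under eq_integral do rewrite hE.
rewrite ge0_integral_fsum//; last by move=> *; exact: nnfun_muleindic_ge0.
under [RHS]eq_integral => x _.
  rewrite hE ge0_mule_fsuml => [|y]; last exact: nnfun_muleindic_ge0.
  over.
rewrite /= ge0_integral_fsum//; last 2 first.
- by move=> y; apply: emeasurable_funM.
- by move=> *; rewrite mule_ge0// nnfun_muleindic_ge0.
apply: eq_fsbigr => r _.
under [LHS]eq_integral do rewrite EFinM.
rewrite integralZl_indic_nnsfun// integral_indic// setIT nuE//.
(* A negative [r] is not a value of [h n], so both sides vanish; a nonnegative one may be moved into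
   the integral. *)
rewrite integral_mkcond; have [r0|r0] := ltP r 0%R.
  rewrite preimage_nnfun0// !integral0_eq ?mule0// => x _.
    by rewrite indicE in_set0 mulr0 mul0e.
  by rewrite patchE in_set0.
rewrite -ge0_integralZl//; last 2 first.
- apply/(@measurable_restrictT _ _ _ _ (h n @^-1` [set r])) => //.
  exact: measurable_funTS.
- by move=> x _; apply: erestrict_ge0.
by apply: eq_integral => x _; rewrite epatch_indic EFinM muleAC muleA.
Qed.
End Density.

(** * Logarithm inequalities, and measurability of the inverse and the logarithm *)

Lemma ln_le_subr1 (R : realType) (x : R) : 0 < x -> ln x <= x - 1.
Proof.
move=> x0; have := @le_ln1Dx R (x - 1).
by rewrite (addrC 1) addrNK; apply; rewrite ltrBDr addNr.
Qed.

(** The inequality [1 + t < exp t] is strict for [t != 0]; take [t = x - 1]. *)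
Lemma ln_eq_subr1 (R : realType) (x : R) : 0 < x -> ln x = x - 1 -> x = 1.
Proof.
move=> x0 lnx; apply/eqP; apply: contraPT (lnK x0) => x1.
by apply/eqP; rewrite gt_eqF// lnx -[ltLHS](addrNK 1) addrC expR_gt1Dx// subr_eq0.
Qed.

Lemma measurable_invr (R : realType) : measurable_fun setT (@GRing.inv R).
Proof.
rewrite -(setvU [set 0 : R]); apply/measurable_funU => //.
  exact: measurableC.
split; last exact: measurable_fun_set1.
apply: open_continuous_measurable_fun.
  by apply: closed_openC; exact: closed_eq.
by move=> x; rewrite inE => /eqP x0; exact: inv_continuous.
Qed.

Lemma measurable_lne (R : realType) : measurable_fun setT (@lne R).
Proof.
have -> : @lne R = fun x => if (x <= 0)%E then -oo%E
    else if x == +oo%E then +oo%E else (ln (fine x))%:E.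
  by apply/funext => -[r| |]//=; rewrite leNgt ?ltNyr ?lt0y.
apply: measurable_fun_ifT => //; first exact: measurable_fun_lee.
apply: measurable_fun_ifT => //.
  apply: (measurable_fun_bool true) => //=.
  rewrite setTI [X in measurable X](_ : _ = [set +oo%E])//.
  by apply/seteqP; split => x /= /eqP.
by apply/measurable_EFinP; apply: measurableT_comp => //; exact: measurable_fine.
Qed.

(** * Gibbs inequality *)

Section AeIntegral.
Local Open Scope ereal_scope.
Context {disp : measure_display} {T : measurableType disp} {R : realType}.
Variable m : {measure set T -> \bar R}.
Implicit Types f g : T -> \bar R.

(** Comparing positive and negative parts separately covers infinite integrals, as the entropy may
    be [-oo]. *)
Lemma ae_le_integral f g :
  measurable_fun setT f -> measurable_fun setT g ->
  {ae m, forall x, f x <= g x} -> \int[m]_x f x <= \int[m]_x g x.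
Proof.
move=> mf mg fg; rewrite integralE [leRHS]integralE leeB//.
- apply: ae_ge0_le_integral => //; try exact: measurable_funepos.
  apply: filterS fg => x fgx _; rewrite !funeposE.
  by rewrite ge_max !le_max fgx lexx orbT.
- apply: ae_ge0_le_integral => //; try exact: measurable_funeneg.
  apply: filterS fg => x fgx _; rewrite !funenegE.
  by rewrite ge_max !le_max leeN2 fgx lexx orbT.
Qed.

(** [g - f] is nonnegative almost everywhere with integral zero, so the integral of its absolute
    value vanishes. *)
Lemma ae_le_integral_eq f g :
  m.-integrable setT f -> m.-integrable setT g ->
  {ae m, forall x, f x <= g x} -> \int[m]_x g x <= \int[m]_x f x ->
  {ae m, forall x, f x = g x}.
Proof.
move=> fi gi fg gf.
have mf := measurable_int _ fi; have mg := measurable_int _ gi.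
have mgf : measurable_fun setT (g \- f) by exact: emeasurable_funB.
have : \int[m]_x `|(g \- f) x| = 0.
  rewrite (@ae_eq_integral _ _ _ m _ (g \- f))//; last 2 first.
  - exact: measurableT_comp.
  - apply: filterS2 fg (integrable_ae measurableT fi) => x fgx /(_ I) fx _.
    by rewrite gee0_abs// sube_ge0 ?fx.
  rewrite integralB// (_ : \int[m]_x f x = \int[m]_x g x) ?subee//.
    exact: integrable_fin_num.
  by apply/eqP; rewrite eq_le gf andbT; exact: ae_le_integral.
move/(ae_eq_integral_abs m measurableT mgf).
apply: filterS3 (integrable_ae measurableT fi) (integrable_ae measurableT gi).
move=> x /(_ I) fx /(_ I) gx /(_ I) /= /eqP.
by rewrite sube_eq ?add0e// ?fin_num_adde_defl// => /eqP.
Qed.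
End AeIntegral.

Section Gibbs.
Local Open Scope ereal_scope.
Context {disp : measure_display} {T : measurableType disp} {R : realType}.
Variables (P : {finite_measure set T -> \bar R}) (g : T -> R).
Hypothesis g_ge0 : forall p, (0 <= g p)%R.
Hypothesis g_null : P [set p | g p = 0%R] = 0.
Hypothesis g_int : P.-integrable setT (EFin \o g).
Hypothesis gV_int : P.-integrable setT (EFin \o (fun p => (g p)^-1)%R).

Let mg : measurable_fun setT g.
Proof. exact/measurable_EFinP/(measurable_int P). Qed.

Lemma ae_gt0 : {ae P, forall p, (0 < g p)%R}.
Proof.
exists [set p | g p = 0%R]; split => //.
  by rewrite -[X in measurable X]setTI; apply: (mg _ (measurable_set1 0%R)).
by move=> p /= /negP; rewrite lt_def g_ge0 andbT negbK => /eqP.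
Qed.

(** [ln t < t] at [g] and at its inverse bounds [|ln g|] by [g + 1 / g]; at a zero of [g] both sides
    take the default value [0]. *)
Lemma integrable_ln : P.-integrable setT (EFin \o (fun p => - ln (g p))%R).
Proof.
apply: le_integrable (integrableD _ g_int gV_int) => //.
  apply/measurable_EFinP/measurableT_comp => //.
  exact: measurableT_comp mg.
move=> p _ /=; rewrite lee_fin normrN [leRHS]ger0_norm ?addr_ge0 ?invr_ge0//.
have [g0|g0] := eqVneq (g p) 0%R; first by rewrite g0 ln0// normr0 invr0 addr0.
have gp : (0 < g p)%R by rewrite lt_def g0 g_ge0.
have gVp : (0 < (g p)^-1)%R by rewrite invr_gt0.
rewrite ler_norml; apply/andP; split.
  rewrite lerNl -lnV ?posrE//.
  by rewrite (le_trans (ltW (ln_sublinear gVp)))// lerDr ltW.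
by rewrite (le_trans (ltW (ln_sublinear gp)))// lerDl ltW.
Qed.

Variable phi : T -> \bar R.
Hypothesis mphi : measurable_fun setT phi.
Hypothesis phi_ge0 : forall p, 0 <= phi p.
Hypothesis gphi_le : \int[P]_p ((g p)%:E * phi p) <= P setT.

(** This is the bound [ln x <= x - 1] at [x = g p * phi p], solved for the logarithm of [phi p]. *)
Let w p := (- ln (g p))%:E + ((g p)%:E * phi p - 1).

Let igphi : P.-integrable setT (fun p => (g p)%:E * phi p).
Proof.
apply/integrableP; split.
  by apply: emeasurable_funM => //; exact: measurable_int g_int.
under eq_integral do rewrite gee0_abs ?mule_ge0 ?lee_fin//.
by rewrite (le_lt_trans gphi_le)// -ge0_fin_numE// fin_num_measure.
Qed.

Let i1 : P.-integrable setT (cst 1%:E).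
Proof. exact: finite_measure_integrable_cst. Qed.

Let iw : P.-integrable setT w.
Proof.
apply: integrableD => //; first exact: integrable_ln.
exact: integrableB.
Qed.

Let w_le : \int[P]_p w p <= \int[P]_p (- ln (g p))%:E.
Proof.
rewrite integralD//; [|exact: integrable_ln|exact: integrableB].
rewrite geeDl// integralB// integral_cst// mul1e.
by rewrite sube_le0.
Qed.

Let gphi_fin : {ae P, forall p, phi p \is a fin_num}.
Proof.
have := integrable_ae measurableT igphi.
apply: filterS2 ae_gt0 => p gp /(_ I) h.
rewrite ge0_fin_numE// ltey; apply/eqP => phioo.
by move: h; rewrite phioo gt0_muley// lte_fin.
Qed.

Let lne_le_w : {ae P, forall p, lne (phi p) <= w p}.
Proof.
apply: filterS2 ae_gt0 gphi_fin => p gp phip.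
rewrite /w -(fineK phip); set x := fine _.
have [x0|x0] := leP x 0%R; first by rewrite le0_lneNy ?lee_fin ?leNye.
rewrite lne_EFin// -EFinM -EFinB -EFinD lee_fin -lerBlDl opprK addrC -lnM ?posrE//.
by rewrite ln_le_subr1// mulr_gt0.
Qed.

(* [- ln (g p)] is [lne (g p)^-1] except on the zeros of [g], where [ln 0 = 0]. *)
Lemma gibbs_le : \int[P]_p lne (phi p) <= \int[P]_p (- ln (g p))%:E.
Proof.
apply: le_trans w_le; apply: ae_le_integral lne_le_w.
  by apply: measurableT_comp => //; exact: measurable_lne.
exact: measurable_int iw.
Qed.

(** Equality of the integrals forces equality in [ln x <= x - 1] almost everywhere, hence
    [g * phi = 1]. *)
Lemma gibbs_eq : \int[P]_p (- ln (g p))%:E <= \int[P]_p lne (phi p) ->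
  {ae P, forall p, phi p = (g p)^-1%:E}.
Proof.
move=> H.
have mlne : measurable_fun setT (@lne R \o phi).
  by apply: measurableT_comp => //; exact: measurable_lne.
have iL := integrable_fin_num measurableT integrable_ln.
(* The integral of [lne phi] is squeezed between finite values; integrability is what the equality
   case of the comparison asks for. *)
have ilne : P.-integrable setT (@lne R \o phi).
  apply/integrableP; split => //; apply/abse_integralP => //.
  rewrite -fin_num_abs fin_numElt; apply/andP; split.
    by apply: lt_le_trans H; rewrite ltNye_eq iL.
  by rewrite (le_lt_trans gibbs_le)// ltey_eq iL.
have := ae_le_integral_eq ilne iw lne_le_w (le_trans w_le H).
apply: filterS3 ae_gt0 gphi_fin => p gp phip.
rewrite /w /= -(fineK phip); set x := fine _.
have [x0|x0] := leP x 0%R; first by rewrite le0_lneNy ?lee_fin.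
rewrite lne_EFin// -EFinM -EFinB -EFinD.
move=> -[] /eqP; rewrite addrC -subr_eq opprK addrC -lnM ?posrE// => /eqP.
move/(ln_eq_subr1 (mulr_gt0 gp x0)) => gx1; congr _%:E.
by rewrite -[RHS]mulr1 -gx1 mulKf// gt_eqF.
Qed.

End Gibbs.

(** * Lebesgue decompositions and entropy on the torus *)

Section DensityMeasure.
Local Open Scope ereal_scope.
Context {disp : measure_display} {T : measurableType disp} {R : realType}.
Variables (m : {measure set T -> \bar R}) (f : T -> \bar R).
Hypotheses (mf : measurable_fun setT f) (f_ge0 : forall x, 0 <= f x).

(** The two proofs are arguments so that the measure structure below can be inferred from the term
    itself. *)
Definition density_measure of measurable_fun setT f & (forall x, 0 <= f x) :=
  fun A : set T => \int[m]_(x in A) f x.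

Let dm := density_measure mf f_ge0.

Let dm0 : dm set0 = 0.
Proof. exact: integral_set0. Qed.

Let dm_ge0 A : 0 <= dm A.
Proof. exact: integral_ge0. Qed.

Let dm_sigma_additive : semi_sigma_additive dm.
Proof.
move=> F mF tF mUF; rewrite /dm /density_measure ge0_integral_bigcup//; last first.
  exact: measurable_funTS.
by apply: is_cvg_ereal_nneg_natsum_cond => n _ _; exact: integral_ge0.
Qed.

HB.instance Definition _ :=
  isMeasure.Build _ _ _ dm dm0 dm_ge0 dm_sigma_additive.

End DensityMeasure.

Section Torus.
Local Open Scope ereal_scope.
Context {R : realType} {d : nat}.
Local Notation T := (torus R d).
Local Notation dp := (@torus_lebesgue R d).
Implicit Types (lam sing : {measure set T -> \bar R}) (f g : T -> \bar R).

Lemma open_torus_measurable (U : set T) : open U -> measurable U.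
Proof. by move=> oU; exact: sub_sigma_algebra. Qed.

Lemma continuous_torus_measurable (u : T -> R) :
  continuous u -> measurable_fun setT u.
Proof.
move=> /continuousP cu; apply: (measurability _ (RGenOpens.measurableE R)).
move=> _ [_ [x [y ->]] <-]; rewrite setTI.
by apply: open_torus_measurable; apply: cu; exact: interval_open.
Qed.

Lemma decomposition_integral lam f sing g :
  lebesgue_decomposition lam f sing ->
  measurable_fun setT g -> (forall p, 0 <= g p) ->
  \int[lam]_p g p = \int[dp]_p (g p * f p) + \int[sing]_p g p.
Proof.
move=> [mf f0 _ lamE] mg g0.
pose fdp : {measure set T -> \bar R} := density_measure dp mf f0.
rewrite (eq_measure_integral (measure_add fdp sing)); last first.
  by move=> A mA _; rewrite lamE//; exact/esym/measure_addE.
rewrite ge0_integral_measure_add//; congr (_ + _).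
exact: (ge0_integral_density mf f0).
Qed.

Lemma decomposition_mass lam f sing : lebesgue_decomposition lam f sing ->
  mass lam = density_mass f + mass sing.
Proof. by move=> [_ _ _ /(_ _ measurableT)]. Qed.

(** Off the union of the two null carriers both singular parts vanish, so there [lam] alone
    determines the integrals of the densities. *)
Lemma decomposition_unique lam f1 s1 f2 s2 : mass lam < +oo ->
  lebesgue_decomposition lam f1 s1 -> lebesgue_decomposition lam f2 s2 ->
  ae_eq dp setT f1 f2.
Proof.
move=> lamoo D1 D2.
have [mf1 f10 [N1 [mN1 N10 s10]] E1] := D1.
have [mf2 f20 [N2 [mN2 N20 s20]] E2] := D2.
have mN : measurable (N1 `|` N2) by exact: measurableU.
have N0 : dp (N1 `|` N2) = 0 by exact: null_set_setU.
apply: integral_ae_eq => //.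
  apply/integrableP; split => //.
  rewrite (eq_integral f1); last by move=> x _; rewrite gee0_abs.
  apply: le_lt_trans lamoo; rewrite /mass E1// leeDl//.
move=> A _ mA.
have off f : measurable_fun setT f -> (forall x, 0 <= f x) ->
    \int[dp]_(x in A) f x = \int[dp]_(x in A `\` (N1 `|` N2)) f x.
  by move=> mf f0; rewrite (@ge0_negligible_integral _ _ _ _ _ (N1 `|` N2))//;
    exact: measurable_funTS.
rewrite off// (off f2)//.
have mAN : measurable (A `\` (N1 `|` N2)) by exact: measurableD.
have s0 (s : {measure set T -> \bar R}) N : measurable N -> s (~` N) = 0 ->
    N `<=` N1 `|` N2 -> s (A `\` (N1 `|` N2)) = 0.
  move=> mN' sN NN; apply: (subset_measure0 _ _ _ sN) => //.
    exact: measurableC.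
  by move=> x [_ nx] Nx; apply: nx; exact: NN.
have := E1 _ mAN; rewrite E2// (s0 s1 N1)// (s0 s2 N2)// !adde0.
by move=> ->.
Qed.

Lemma entropy_decomposition lam f sing : mass lam < +oo ->
  lebesgue_decomposition lam f sing -> entropy lam = \int[dp]_p lne (f p).
Proof.
move=> lamoo D; rewrite /entropy.
have [s Ds] : exists s, lebesgue_decomposition lam (ac_density lam) s.
  have := @xgetPex _ (cst 0) [set f | exists s, lebesgue_decomposition lam f s].
  by apply; exists f, sing.
have [mf _ _ _] := D; have [ma _ _ _] := Ds.
apply: ae_eq_integral => //.
- by apply: measurableT_comp => //; exact: measurable_lne.
- by apply: measurableT_comp => //; exact: measurable_lne.
apply: filterS (decomposition_unique lamoo Ds D) => p.
by move=> /(_ I) -> _.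
Qed.

(* [ac_density] then takes its default value 0; thanks to this, the Lebesgue
   decomposition theorem is never needed. *)
Lemma entropy_no_decomposition lam :
  ~ (exists f sing, lebesgue_decomposition lam f sing) -> entropy lam = -oo.
Proof.
move=> nD; rewrite /entropy /ac_density xgetPN; last first.
  by move=> f [s D]; apply: nD; exists f, s.
rewrite (eq_integral (cst -oo)); last by move=> p _; exact: le0_lneNy.
rewrite integral_cst// [X in _ * X]torus_lebesgueT.
by rewrite gt0_mulNye// lte_fin exprn_gt0// mulr_gt0// pi_gt0.
Qed.

End Torus.

Section Affine.
Local Open Scope ereal_scope.
Context {disp : measure_display} {T : measurableType disp} {R : realType}.
Variables (m : {measure set T -> \bar R}) (u : T -> R).

Lemma integral_affine (x y U M : R) : m.-integrable setT (EFin \o u) ->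
  m setT = M%:E -> \int[m]_p (u p)%:E = U%:E ->
  \int[m]_p (x * u p + y)%:E = (x * U + y * M)%:E.
Proof.
move=> iu mT uU.
have iy : m.-integrable setT (cst y%:E).
  apply/integrableP; split => //.
  by rewrite integral_cst// mT /= -EFinM ltry.
under eq_integral do rewrite EFinD EFinM.
rewrite integralD//; last exact: integrableZl.
by rewrite integralZl// uU integral_cst// mT -!EFinM -EFinD.
Qed.

End Affine.

(** * Rayleigh-Jeans equilibria *)

Section RayleighJeans.
Local Open Scope ereal_scope.
Context {R : realType} {d : nat}.
Local Notation T := (torus R d).
Local Notation dp := (@torus_lebesgue R d).
Variable omega : T -> R.
Hypothesis momega : measurable_fun setT omega.
Hypothesis omega_ge0 : forall p, (0 <= omega p)%R.
Hypothesis omega_le1 : forall p, (omega p <= 1)%R.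
Variable munu : R * R.
Local Notation h := (fun p => munu.1 * omega p + munu.2)%R.
Local Notation RJ := (rayleigh_jeans omega munu).

Let mh : measurable_fun setT h.
Proof. by apply: measurable_funD => //; exact: measurable_funM. Qed.

Lemma measurable_affine_zeros : measurable [set p : T | h p = 0%R].
Proof. by rewrite -[X in measurable X]setTI; apply: (mh _ (measurable_set1 0%R)). Qed.

Lemma measurable_rayleigh_jeans : measurable_fun setT RJ.
Proof.
have -> : RJ = fun p => if h p == 0%R then +oo else ((h p)^-1)%:E.
  by apply/funext => p; rewrite /rayleigh_jeans inver.
apply: measurable_fun_ifT => //.
  exact: measurable_fun_eqr.
apply/measurable_EFinP; exact: measurableT_comp (@measurable_invr R) mh.
Qed.

Lemma integrable_affine : dp.-integrable setT (EFin \o h).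
Proof.
apply: (@le_integrable _ _ _ _ _ _ _ (cst (`|munu.1| + `|munu.2|)%:E)) => //.
- exact/measurable_EFinP.
- move=> p _ /=; rewrite lee_fin [leRHS]ger0_norm ?addr_ge0//.
  rewrite (le_trans (ler_normD _ _))// lerD2r normrM ler_piMr//.
  by rewrite ger0_norm.
- exact: finite_measure_integrable_cst.
Qed.

Hypothesis h_ge0 : forall p, (0 <= h p)%R.

Lemma rayleigh_jeans_ge0 p : 0 <= RJ p.
Proof. by rewrite /rayleigh_jeans inve_ge0 lee_fin. Qed.

Section NullZeros.
Hypothesis h_null : dp [set p | h p = 0%R] = 0.

(** At a zero of [h] the extended inverse is [+oo] and the real inverse is [0]; they differ only on
    this null set. *)
Lemma ae_rayleigh_jeans : {ae dp, forall p, RJ p = ((h p)^-1)%:E}.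
Proof.
exists [set p | h p = 0%R]; split => //; first exact: measurable_affine_zeros.
move=> p /=; apply: contra_notP => /eqP/negbTE hp.
by rewrite /rayleigh_jeans inver hp.
Qed.

Lemma density_massE : density_mass RJ = \int[dp]_p ((h p)^-1)%:E.
Proof.
apply: ae_eq_integral => //.
- exact: measurable_rayleigh_jeans.
- by apply/measurable_EFinP; exact: measurableT_comp (@measurable_invr R) mh.
- by apply: filterS ae_rayleigh_jeans => p ->.
Qed.

Lemma density_energyE :
  density_energy omega RJ = \int[dp]_p (omega p * (h p)^-1)%:E.
Proof.
apply: ae_eq_integral => //.
- by apply: emeasurable_funM; [exact/measurable_EFinP|exact: measurable_rayleigh_jeans].
- apply/measurable_EFinP; apply: measurable_funM => //.
  exact: measurableT_comp (@measurable_invr R) mh.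
- by apply: filterS ae_rayleigh_jeans => p ->.
Qed.

(** Thus [RJ] turns the constraint [gphi_le] of the Gibbs inequality into an equality. *)
Lemma integral_affine_rj : \int[dp]_p ((h p)%:E * RJ p) = dp setT.
Proof.
rewrite -[RHS]mul1e -integral_cst//; apply: ae_eq_integral => //.
- by apply: emeasurable_funM; [exact/measurable_EFinP|exact: measurable_rayleigh_jeans].
- exists [set p | h p = 0%R]; split => //; first exact: measurable_affine_zeros.
  move=> p /=; apply: contra_notP => /eqP hp _.
  by rewrite /rayleigh_jeans inver (negbTE hp) -EFinM divff.
Qed.

Hypothesis RJ_fin : density_mass RJ < +oo.

Lemma integrable_affineV : dp.-integrable setT (EFin \o (fun p => (h p)^-1)%R).
Proof.
apply/integrableP; split.
  by apply/measurable_EFinP; exact: measurableT_comp (@measurable_invr R) mh.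
under eq_integral do rewrite /= ger0_norm ?invr_ge0//.
by rewrite -density_massE.
Qed.

(** The Gibbs bound is attained at [RJ], whatever the singular part is. *)
Lemma entropy_rayleigh_jeans lam sing : mass lam < +oo ->
  lebesgue_decomposition lam RJ sing ->
  entropy lam = \int[dp]_p (- ln (h p))%:E.
Proof.
move=> lamoo D; rewrite (entropy_decomposition lamoo D).
apply: ae_eq_integral => //.
- by apply: measurableT_comp (@measurable_lne R) measurable_rayleigh_jeans.
- by apply/measurable_EFinP; apply: measurableT_comp => //; exact: measurableT_comp mh.
- apply: filterS2 (ae_gt0 h_ge0 h_null integrable_affine) ae_rayleigh_jeans.
  by move=> p hp -> _; rewrite lne_EFin ?invr_gt0// lnV.
Qed.

Variables (M0 E0 : R).
Hypothesis munuME : (munu.1 * E0 + munu.2 * M0 = (2 * pi) ^+ d)%R.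
Variable lam : {measure set T -> \bar R}.
Hypothesis lam_feasible : feasible omega M0 E0 lam.

Let lamoo : mass lam < +oo.
Proof. by have [-> _] := lam_feasible; rewrite ltry. Qed.

(** [munuME] is what gives [h] the same integral [(2 * pi) ^+ d] against every feasible measure. *)
Let lam_affine : \int[lam]_p (h p)%:E = dp setT.
Proof.
have [lamM lamE] := lam_feasible.
rewrite (integral_affine _ _ _ lamM lamE) ?munuME ?torus_lebesgueT//.
apply/integrableP; split; first exact/measurable_EFinP.
under eq_integral do rewrite /= ger0_norm//.
by move: lamE; rewrite /energy => ->; rewrite ltry.
Qed.

Let affine_decomposition f s : lebesgue_decomposition lam f s ->
  \int[dp]_p ((h p)%:E * f p) + \int[s]_p (h p)%:E = dp setT.
Proof.
move=> D; rewrite -(decomposition_integral D) ?lam_affine//.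
exact/measurable_EFinP.
Qed.

(** The singular part contributes nonnegatively to the integral of [h], so the density satisfies the
    hypothesis [gphi_le] of the Gibbs inequality. *)
Lemma entropy_le : entropy lam <= \int[dp]_p (- ln (h p))%:E.
Proof.
have [[f [s D]]|nD] := pselect (exists f s, lebesgue_decomposition lam f s); last first.
  by rewrite entropy_no_decomposition ?leNye.
rewrite (entropy_decomposition lamoo D).
have [mf f0 _ _] := D.
apply: gibbs_le => //; [exact: integrable_affine|exact: integrable_affineV|].
by rewrite -[leRHS](affine_decomposition D) leeDl// integral_ge0// => p _; rewrite lee_fin.
Qed.

(** Equality in the Gibbs bound identifies the density with [RJ]. Since [RJ] alone already gives [h]
    its full integral, [h] integrates to zero against the singular part. *)
Lemma entropy_eq_decomposition :
  \int[dp]_p (- ln (h p))%:E <= entropy lam ->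
  exists sing, lebesgue_decomposition lam RJ sing /\
    supported_on sing [set p | h p = 0%R].
Proof.
have iL := integrable_fin_num measurableT
  (integrable_ln h_ge0 integrable_affine integrable_affineV).
have [[f [s D]]|nD] := pselect (exists f s, lebesgue_decomposition lam f s); last first.
  rewrite entropy_no_decomposition// leeNy_eq => /eqP LNy.
  by move: iL; rewrite LNy.
rewrite (entropy_decomposition lamoo D) => H.
have [mf f0 ss lamE] := D.
have hf : \int[dp]_p ((h p)%:E * f p) <= dp setT.
  by rewrite -[leRHS](affine_decomposition D) leeDl// integral_ge0// => p _; rewrite lee_fin.
have fRJ : {ae dp, forall p, f p = RJ p}.
  have := gibbs_eq h_ge0 h_null integrable_affine integrable_affineV mf f0 hf H.
  by apply: filterS2 ae_rayleigh_jeans => p -> ->.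
have D' : lebesgue_decomposition lam RJ s.
  split => //; [exact: measurable_rayleigh_jeans|exact: rayleigh_jeans_ge0|].
  move=> A mA; rewrite lamE//; congr (_ + _); apply: ae_eq_integral => //.
  - exact: measurable_funTS.
  - exact: measurable_funTS measurable_rayleigh_jeans.
  - by apply: filterS fRJ => p ->.
exists s; split => //.
have s0 : \int[s]_p (h p)%:E = 0.
  have := affine_decomposition D'; rewrite integral_affine_rj addeC.
  by move=> /(congr1 (fun z => z - dp setT)); rewrite addeK ?subee ?fin_num_measure.
have /(ae_eq_integral_abs s measurableT) : \int[s]_p `|(h p)%:E| = 0.
  by under eq_integral do rewrite gee0_abs ?lee_fin//.
case=> [|N [mN sN subN]]; first exact/measurable_EFinP.
apply: (subset_measure0 _ mN _ sN).
  by apply: measurableC; exact: measurable_affine_zeros.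
by move=> p /= hp; apply: subN => /= /(_ I) [].
Qed.

End NullZeros.
End RayleighJeans.

(** * Full support of Lebesgue measure on the torus *)

Section FullSupport.
Local Open Scope ereal_scope.
Context {R : realType}.
Local Notation BR := (measurableTypeR R).

(** The box extends upwards from [t], because at a coordinate [0] the cube lies only on that
    side. *)
Definition half_open_box n (t : n.-tuple BR) (e : R) : set (n.-tuple BR) :=
  [set s | forall i, (tnth t i <= tnth s i < tnth t i + e)%R].

Lemma measurable_half_open_box n (t : n.-tuple BR) e :
  measurable (half_open_box t e).
Proof.
rewrite (_ : half_open_box t e = \bigcap_(i in [set: 'I_n])
    [set s | tnth s i \in `[tnth t i, (tnth t i + e)%R[]).
  apply: fin_bigcap_measurable => // i _.
  rewrite -[X in measurable X]setTI.
  by apply: (@measurable_tnth _ BR n i measurableT _ (measurable_itv _)).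
apply/seteqP; split => s bs i; first by move=> _ /=; rewrite in_itv/= bs.
by have := bs i I; rewrite /= in_itv.
Qed.

Lemma lebesgue_0_2pi_gt0 (x e : R) : (0 <= x < 2 * pi)%R -> (0 < e)%R ->
  0 < @lebesgue_0_2pi R `[x, (x + e)%R[%classic.
Proof.
move=> /andP[x0 x2pi] e0.
have -> : @lebesgue_0_2pi R `[x, (x + e)%R[%classic =
    lebesgue_measure (`[x, (x + e)%R[ `&` `[0%R, (2 * pi)%R[ : set BR)%classic.
  by [].
(* The interval may leave [[0, 2 pi[]; the part below [min (x + e) (2 pi)] still has positive
   length. *)
apply: (@lt_le_trans _ _ (@lebesgue_measure R `[x, (Num.min (x + e) (2 * pi))%R[)).
  rewrite lebesgue_measure_itv /= lte_fin lt_min ltrDl e0 x2pi/= -EFinB lte_fin.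
  by rewrite subr_gt0 lt_min ltrDl e0 x2pi.
apply: le_measure; rewrite ?inE//.
  by apply: measurableI.
move=> y /=; rewrite !in_itv/= lt_min => /andP[xy /andP[-> ->]].
by rewrite xy (le_trans x0 xy).
Qed.

Lemma cube_lebesgue_box_gt0 n (t : n.-tuple BR) (e : R) :
  (forall i, 0 <= tnth t i < 2 * pi)%R -> (0 < e)%R ->
  0 < cube_lebesgue n (half_open_box t e).
Proof.
move=> + e0; elim: n t => [|n IH] t t2pi.
  by rewrite /= diracE mem_set ?lte_fin ?ltr01// => -[].
case/tupleP: t t2pi => x t t2pi.
have x2pi : (0 <= x < 2 * pi)%R by have := t2pi ord0; rewrite tnth0.
have /IH IHt : forall i, (0 <= tnth t i < 2 * pi)%R.
  by move=> i; have := t2pi (lift ord0 i); rewrite tnthS.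
rewrite /= /cube_step /pushforward.
apply: (@lt_le_trans _ _
  ((@lebesgue_0_2pi R \x cube_lebesgue n)
     (`[x, (x + e)%R[%classic `*` half_open_box t e))).
  rewrite product_measure1E//; last exact: measurable_half_open_box.
  by rewrite mule_gt0// lebesgue_0_2pi_gt0.
apply: le_measure; rewrite ?inE.
- by apply: measurableX => //; exact: measurable_half_open_box.
- rewrite -[X in measurable X]setTI.
  apply: (measurable_funP (@tuple_cons R n)) => //.
  exact: measurable_half_open_box.
move=> [y s] [/= xy bs] i; rewrite /tuple_cons/=.
case: (unliftP ord0 i) => [j ->|->].
  by rewrite !tnthS; exact: bs.
by rewrite !tnth0; move: xy; rewrite in_itv.
Qed.

(** A point of [U] is lifted to the cube, where the preimage of [U] contains a small box. *)
Lemma torus_lebesgue_open_gt0 d (U : set (torus R d)) :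
  open U -> U !=set0 -> 0 < torus_lebesgue U.
Proof.
move=> oU [q Uq].
pose W : set 'rV[R]_d := (\pi_(torus R d) @^-1` U)%qT.
have oW : open W := oU.
pose x : 'rV[R]_d := repr q.
(* The representative [x], reduced modulo [2 pi] into [[0, 2 pi[] in each coordinate. *)
pose y : 'rV[R]_d := \row_i (x ord0 i - 2 * pi * (Num.floor (x ord0 i / (2 * pi)))%:~R)%R.
have twopi : (0 < 2 * pi :> R)%R by rewrite mulr_gt0// pi_gt0.
have Wy : W y.
  rewrite /W /= (_ : (\pi_(torus R d) y)%qT = q) // -[RHS]reprK.
  apply/eqmodP/asboolP; exists (- \row_i Num.floor (x ord0 i / (2 * pi)))%R.
  by apply/rowP => i; rewrite !mxE rmorphN mulrN addrC addKr.
have /nbhs_ballP[e /= e0 eW] : nbhs y W by exact: open_nbhs_nbhs.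
pose t : d.-tuple BR := [tuple y ord0 i | i < d].
apply: (@lt_le_trans _ _ (cube_lebesgue d (half_open_box t e))).
  apply: cube_lebesgue_box_gt0 => // i; rewrite tnth_mktuple mxE.
  set r := (x ord0 i / (2 * pi))%R.
  have -> : (x ord0 i - 2 * pi * (Num.floor r)%:~R =
      (r - (Num.floor r)%:~R) * (2 * pi))%R.
    by rewrite mulrBl mulfVK ?gt_eqF// [(2 * pi * _)%R]mulrC.
  rewrite mulr_ge0 ?subr_ge0 ?ge_floor ?(ltW twopi)//= -[ltRHS]mul1r.
  by rewrite ltr_pM2r// ltrBlDl -intrD1 floorD1_gt.
apply: le_measure; rewrite ?inE.
- exact: measurable_half_open_box.
- exact: (@open_tuple_measurable R d W oW).
move=> s bs; rewrite /tuple_proj /=; apply: eW; split => // i j; rewrite !mxE.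
have := bs j; rewrite tnth_mktuple mxE /= => /andP[ys sy].
rewrite /ball/= distrC ger0_norm ?subr_ge0//.
by rewrite ltrBlDl.
Qed.

End FullSupport.

(** * Uniqueness of the equilibrium with given mass and energy *)

Section RJUnique.
Local Open Scope ereal_scope.
Context {R : realType} {d : nat}.
Local Notation T := (torus R d).
Local Notation dp := (@torus_lebesgue R d).
Variable omega : T -> R.
Hypothesis momega : measurable_fun setT omega.
Hypothesis omega_ge0 : forall p, (0 <= omega p)%R.
Hypothesis omega_le1 : forall p, (omega p <= 1)%R.
Implicit Types munu : R * R.
Local Notation aff munu := (fun p => munu.1 * omega p + munu.2)%R.
Local Notation RJ munu := (rayleigh_jeans omega munu).

(** [RJ] is [+oo] at these zeros, and an integrable function is finite almost everywhere. *)
Lemma rayleigh_jeans_null_zeros munu : (forall p, 0 <= aff munu p)%R ->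
  density_mass (RJ munu) < +oo -> dp [set p | aff munu p = 0%R] = 0.
Proof.
move=> h0 Moo.
have iRJ : dp.-integrable setT (RJ munu).
  apply/integrableP; split; first exact: measurable_rayleigh_jeans.
  by under eq_integral do rewrite gee0_abs ?rayleigh_jeans_ge0//.
have [N [mN N0 subN]] := integrable_ae measurableT iRJ.
apply: (subset_measure0 _ mN _ N0); first exact: measurable_affine_zeros.
move=> p /= hp; apply: subN => /= /(_ I).
by rewrite /rayleigh_jeans inver hp eqxx.
Qed.

Lemma integrable_affine_ratio munu x y : (forall p, 0 <= aff munu p)%R ->
  density_mass (RJ munu) < +oo ->
  dp.-integrable setT (EFin \o (fun p => (x * omega p + y) / aff munu p)%R).
Proof.
move=> h0 Moo; have null := rayleigh_jeans_null_zeros h0 Moo.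
have iV := integrable_affineV momega h0 null Moo.
have := integrableZl measurableT (`|x| + `|y|)%R iV.
apply: le_integrable => //.
  apply/measurable_EFinP; apply: measurable_funM.
    by apply: measurable_funD => //; exact: measurable_funM.
  by apply/measurable_EFinP; exact: measurable_int iV.
move=> p _ /=; rewrite lee_fin !normrM ler_wpM2r// [leRHS]ger0_norm ?addr_ge0//.
rewrite (le_trans (ler_normD _ _))// lerD2r normrM ler_piMr//.
by rewrite ger0_norm.
Qed.

Lemma integral_affine_ratio munu M E x y : rj_with_mass_energy omega M E munu ->
  \int[dp]_p ((x * omega p + y) / aff munu p)%:E = (x * E + y * M)%:E.
Proof.
move=> [[_ h0] rM rE].
have Moo : density_mass (RJ munu) < +oo by rewrite rM ltry.
have null := rayleigh_jeans_null_zeros h0 Moo.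
have iw := integrable_affine_ratio 1 0 h0 Moo.
have i1 := integrable_affine_ratio 0 1 h0 Moo.
have -> : \int[dp]_p ((x * omega p + y) / aff munu p)%:E =
    \int[dp]_p (x%:E * ((1 * omega p + 0) / aff munu p)%:E +
                y%:E * ((0 * omega p + 1) / aff munu p)%:E).
  apply: eq_integral => p _; rewrite -!EFinM -EFinD; congr _%:E.
  by rewrite mul0r add0r mul1r addr0 mulrDl mul1r mulrA.
rewrite integralD//; [|exact: integrableZl..].
rewrite !integralZl// EFinD !EFinM; congr (_ * _ + _ * _).
- rewrite -rE density_energyE//.
  by apply: eq_integral => p _; rewrite mul1r addr0.
- rewrite -rM density_massE//.
  by apply: eq_integral => p _; rewrite mul0r add0r mul1r.
Qed.

(** Integrate the ratio of the affine function to itself. This is the constraint [munuME] for the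
    mass and energy of the equilibrium itself. *)
Lemma rayleigh_jeans_relation munu M E : rj_with_mass_energy omega M E munu ->
  (munu.1 * E + munu.2 * M = (2 * pi) ^+ d)%R.
Proof.
move=> rj; have [[_ h0] rM rE] := rj.
have Moo : density_mass (RJ munu) < +oo by rewrite rM ltry.
have null := rayleigh_jeans_null_zeros h0 Moo.
apply: EFin_inj; rewrite -(integral_affine_ratio _ _ rj) -torus_lebesgueT.
rewrite -[RHS]mul1e -integral_cst//; apply: ae_eq_integral => //.
  exact: measurable_int (integrable_affine_ratio _ _ h0 Moo).
apply: filterS (ae_gt0 h0 null (integrable_affine _ _ _ _)) => // p hp _.
by rewrite divff// gt_eqF.
Qed.

Hypothesis omega_cont : continuous omega.

(* By AM-GM, two solutions h1, h2 satisfy h1 / h2 + h2 / h1 >= 2 almost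
   everywhere, while both sides have the same integral 2 (2 pi)^d.  So h1 = h2
   almost everywhere, hence everywhere because nonempty open sets have positive
   measure. *)
Lemma rayleigh_jeans_unique munu1 munu2 M E :
  (exists p q, omega p != omega q) ->
  rj_with_mass_energy omega M E munu1 -> rj_with_mass_energy omega M E munu2 ->
  munu1 = munu2.
Proof.
move=> [p0 [q0 pq]] rj1 rj2.
have [[_ h10] rM1 rE1] := rj1; have [[_ h20] rM2 rE2] := rj2.
have Moo1 : density_mass (RJ munu1) < +oo by rewrite rM1 ltry.
have Moo2 : density_mass (RJ munu2) < +oo by rewrite rM2 ltry.
have null1 := rayleigh_jeans_null_zeros h10 Moo1.
have null2 := rayleigh_jeans_null_zeros h20 Moo2.
have i12 := integrable_affine_ratio munu1.1 munu1.2 h20 Moo2.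
have i21 := integrable_affine_ratio munu2.1 munu2.2 h10 Moo1.
have pos1 := ae_gt0 h10 null1 (integrable_affine momega omega_ge0 omega_le1 munu1).
have pos2 := ae_gt0 h20 null2 (integrable_affine momega omega_ge0 omega_le1 munu2).
have : {ae dp, forall p, 2%:E =
    (aff munu1 p / aff munu2 p)%:E + (aff munu2 p / aff munu1 p)%:E}.
  apply: (@ae_le_integral_eq _ _ _ dp (cst 2%:E)).
  - exact: finite_measure_integrable_cst.
  - exact: integrableD.
  - apply: filterS2 pos1 pos2 => p h1 h2.
    rewrite -EFinD lee_fin addf_div ?gt_eqF// ler_pdivlMr ?mulr_gt0//.
    by have := sqr_ge0 (aff munu1 p - aff munu2 p); rewrite /=; nra.
  - rewrite integralD//.
    rewrite (integral_affine_ratio _ _ rj2) (integral_affine_ratio _ _ rj1).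
    rewrite (rayleigh_jeans_relation rj1) (rayleigh_jeans_relation rj2).
    rewrite integral_cst// [X in _ * X]torus_lebesgueT.
    by rewrite -EFinD -EFinM lee_fin; lra.
move=> ae2.
have aeq : {ae dp, forall p, aff munu1 p = aff munu2 p}.
  apply: filterS3 pos1 pos2 ae2 => p h1 h2.
  rewrite -EFinD addf_div ?gt_eqF// => -[].
  move=> /(congr1 ( *%R^~ (aff munu2 p * aff munu1 p)%R)).
  rewrite divfK ?mulf_neq0 ?gt_eqF// => e.
  apply/eqP; rewrite -subr_eq0 -sqrf_eq0; apply/eqP.
  move: e; rewrite /=.
  move: (munu1.1 * _ + _)%R (munu2.1 * _ + _)%R => x y e.
  have -> : ((x - y) ^+ 2 = x * x + y * y - 2 * (y * x))%R by ring.
  by rewrite e subrr.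
have open_ne : open [set p | aff munu1 p != aff munu2 p].
  pose V : set R := [set w | munu1.1 * w + munu1.2 != munu2.1 * w + munu2.2]%R.
  have oV : open V.
    rewrite (_ : V = (fun w => munu1.1 * w + munu1.2 - (munu2.1 * w + munu2.2))%R
        @^-1` [set~ 0%R]); last first.
      by apply/seteqP; split => w; rewrite /V /= -subr_eq0 => /eqP.
    apply: open_comp; last by apply: closed_openC; exact: closed_eq.
    move=> w _; apply: cvgB; (apply: cvgD; last exact: cvg_cst);
      by apply: cvgM; [exact: cvg_cst|exact: cvg_id].
  by have /continuousP/(_ V oV) := omega_cont.
have eqh p : aff munu1 p = aff munu2 p.
  apply/eqP; apply: contrapT => /negP ne.
  have : 0 < dp [set p | aff munu1 p != aff munu2 p].
    by apply: torus_lebesgue_open_gt0 => //; exists p.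
  case: aeq => N [mN N0 subN]; apply/negP; rewrite -leNgt -N0.
  apply: le_measure; rewrite ?inE//; first exact: open_torus_measurable.
  by move=> q /= /eqP; exact: subN.
(* Affine functions of [omega] that agree at two distinct values of [omega] have the same
   coefficients. *)
have ep := eqh p0; have eq := eqh q0.
have e1 : munu1.1 = munu2.1.
  apply/eqP; rewrite -subr_eq0; move: pq; rewrite -subr_eq0.
  apply: contraNT => n0; have : ((munu1.1 - munu2.1) * (omega p0 - omega q0) = 0)%R.
    by move: ep eq; rewrite /=; nra.
  by move/eqP; rewrite mulf_eq0 (negbTE n0).
move: ep; rewrite /= e1 => /addrI e2.
by rewrite [munu1]surjective_pairing e1 e2 -surjective_pairing.
Qed.

End RJUnique.

(** * Equilibria between the thresholds *)

Section InteriorRoot.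
Context {disp : measure_display} {T : measurableType disp} {R : realType}.
Variable P : {finite_measure set T -> \bar R}.

(** At [x = 0] the terms are [n.+1], which tend to [+oo], the extended inverse of [0]. *)
Lemma cvg_inve_harmonic (x : R) : 0 <= x ->
  ((x + n.+1%:R^-1)^-1)%:E @[n --> \oo] --> ((x%:E)^-1)%E.
Proof.
move=> x0; have [->|xn0] := eqVneq x 0.
  rewrite inver eqxx; apply/cvgeryP.
  rewrite (_ : (fun n => _) = (fun n => n.+1%:R)); last first.
    by apply/funext => n; rewrite add0r invrK.
  by rewrite (cvg_shiftS (fun n => n%:R : R)); exact: cvgr_idn.
rewrite inver (negbTE xn0); apply: cvg_EFin; first exact: nearW.
apply: cvgV => //; rewrite -[X in _ --> X]addr0; apply: cvgD; first exact: cvg_cst.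
exact: cvg_harmonic.
Qed.

(** [1 / (x + 1 / (n + 1))] increases to [1 / x], so by monotone convergence some term already has
    integral above [P setT]. This carries a strict inequality at an end of the parameter interval
    into its interior. *)
Lemma interior_inv_integral_gt (x : T -> R) : measurable_fun setT x ->
  (forall p, 0 <= x p) -> (P setT < \int[P]_p ((x p)%:E)^-1)%E ->
  exists t, 0 < t < 1 /\ (P setT < \int[P]_p (((1 - t) + t * x p)^-1)%:E)%E.
Proof.
move=> mx x0 PH; apply: contrapT => nex.
suff : (\int[P]_p ((x p)%:E)^-1 <= P setT)%E by rewrite leNgt PH.
have xn0 p n : 0 < x p + n.+1%:R^-1 by rewrite ltr_wpDl.
have mxn n : measurable_fun setT (fun p => ((x p + n.+1%:R^-1)^-1)%:E).
  apply/measurable_EFinP; apply: measurableT_comp (@measurable_invr R) _.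
  exact: measurable_funD.
rewrite (eq_integral (fun p => limn (fun n => ((x p + n.+1%:R^-1)^-1)%:E))); last first.
  by move=> p _; apply/esym/cvg_lim => //; exact: cvg_inve_harmonic.
rewrite monotone_convergence//; last 2 first.
- by move=> n p _; rewrite lee_fin invr_ge0 ltW.
- move=> p _ a b ab; rewrite lee_fin lef_pV2 ?posrE// lerD2l lef_pV2 ?posrE//.
  by rewrite ler_nat.
apply: lime_le.
  apply: ereal_nondecreasing_is_cvgn => a b ab; apply: ge0_le_integral => //.
  - by move=> p _; rewrite lee_fin invr_ge0 ltW.
  - move=> p _; rewrite lee_fin lef_pV2 ?posrE// lerD2l lef_pV2 ?posrE//.
    by rewrite ler_nat.
apply: nearW => n; rewrite leNgt; apply/negP => Pn; apply: nex.
have n1 : 0 < n.+1%:R :> R by [].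
have n2 : 0 < n.+2%:R :> R by [].
(* For this [t], [(1 - t) + t * x = t * (x + 1 / (n + 1))], which is at most [x + 1 / (n + 1)]. *)
exists (n.+1%:R / n.+2%:R); split.
  by rewrite divr_gt0//= ltr_pdivrMr// mul1r ltr_nat.
apply: (lt_le_trans Pn); apply: ge0_le_integral => //.
- by move=> p _; rewrite lee_fin invr_ge0 ltW.
- apply/measurable_EFinP; apply: measurableT_comp (@measurable_invr R) _.
  by apply: measurable_funD => //; exact: measurable_funM.
- move=> p _; rewrite lee_fin lef_pV2 ?posrE//; last first.
    rewrite ltr_wpDr ?mulr_ge0 ?divr_ge0// subr_gt0.
    by rewrite ltr_pdivrMr// mul1r ltr_nat.
  have -> : 1 - n.+1%:R / n.+2%:R = n.+1%:R / n.+2%:R * n.+1%:R^-1 :> R.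
    rewrite mulrAC divff ?gt_eqF// mul1r -[X in X - _](@divff _ n.+2%:R) ?gt_eqF//.
    by rewrite -mulrBl -natrB// subSnn mul1r.
  rewrite addrC -mulrDr ler_piMl//; first exact: ltW.
  by rewrite ler_pdivrMr// mul1r ler_nat.
Qed.

Variables (A B : R) (u : T -> R).
Hypotheses (A0 : A < 0) (B0 : 0 < B) (mu : measurable_fun setT u).
Hypotheses (Au : forall p, A <= u p) (uB : forall p, u p <= B).

(** For [u] in [[A, B]], [1 + s * u] is nonnegative when [s] is in [[-1 / B, -1 / A]]; scaling this
    interval by [t < 1] leaves the margin [1 - t]. *)
Lemma affine_ge (t s : R) p : t < 1 -> - t / B <= s <= - t / A -> 1 - t <= 1 + s * u p.
Proof.
move=> t1; rewrite ler_pdivrMr// ler_ndivlMr//  => /andP[sB sA].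
rewrite lerD2l; have [s0|s0] := leP 0 s.
  by have := ler_wpM2l s0 (Au p); nra.
by have := ler_wnM2l (ltW s0) (uB p); nra.
Qed.

(** [|u| <= B - A], and the denominator is at least [1 - t]. The bound is uniform in [s] and serves
    as dominating function for continuity in [s]. *)
Lemma norm_affine_ratio_le (t s : R) p : t < 1 -> - t / B <= s <= - t / A ->
  `|u p / (1 + s * u p)| <= (B - A) / (1 - t).
Proof.
move=> t1 /(affine_ge p t1) k; have t0 : 0 < 1 - t by rewrite subr_gt0.
rewrite normrM normfV (ger0_norm (le_trans (ltW t0) k)).
apply: ler_pM => //; first by rewrite invr_ge0 (le_trans (ltW t0) k).
  rewrite ler_norml opprB (le_trans _ (Au p)) ?(le_trans (uB p))//.
    by rewrite lerDl oppr_ge0 ltW.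
  by rewrite gerDl oppr_le0 ltW.
by rewrite lef_pV2 ?posrE// (lt_le_trans t0 k).
Qed.

Let mF (s : R) : measurable_fun setT (fun p => u p / (1 + s * u p)).
Proof.
apply: measurable_funM => //; apply: measurableT_comp (@measurable_invr R) _.
by apply: measurable_funD => //; exact: measurable_funM.
Qed.

Lemma integrable_bounded_ratio (t s : R) : t < 1 -> - t / B <= s <= - t / A ->
  P.-integrable setT (EFin \o (fun p => u p / (1 + s * u p))).
Proof.
move=> t1 st.
apply: (@le_integrable _ _ _ _ _ _ _ (cst ((B - A) / (1 - t))%:E)) => //.
- exact/measurable_EFinP.
- move=> p _ /=; rewrite lee_fin (le_trans (norm_affine_ratio_le p t1 st))//.
  exact: ler_norm.
- exact: finite_measure_integrable_cst.
Qed.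

(** Integrate [1 / k = 1 - s * u / k] with [k = 1 + s * u]. *)
Lemma integral_affine_inv (t s : R) : t < 1 -> - t / B <= s <= - t / A ->
  (\int[P]_p ((1 + s * u p)^-1)%:E =
   (fine (P setT) - s * \int[P]_p (u p / (1 + s * u p)))%:E)%E.
Proof.
move=> t1 st; have iF := integrable_bounded_ratio t1 st.
have fV : (P setT = (fine (P setT))%:E)%E by rewrite fineK// fin_num_measure.
transitivity (\int[P]_p (1%:E - s%:E * (u p / (1 + s * u p))%:E))%E.
  apply: eq_integral => p _; rewrite -EFinM -EFinB; congr _%:E.
  have k0 : 1 + s * u p != 0.
    by rewrite gt_eqF// (lt_le_trans _ (affine_ge p t1 st))// subr_gt0.
  by apply: (mulIf k0); rewrite mulVf// mulrBl mulrA divfK// mul1r addrK.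
rewrite integralB//; last 2 first.
- exact: finite_measure_integrable_cst.
- exact: integrableZl.
rewrite integral_cst// mul1e integralZl// EFinB EFinM fineK ?fin_num_measure//.
by congr (_ - _ * _)%E; rewrite fineK// integrable_fin_num.
Qed.

(** The hypotheses concern [s = -1 / A] and [s = -1 / B], where [1 + s * u] may vanish. Both are
    moved inwards, to a positive and a negative [s] with [s * F s < 0], and the intermediate value
    theorem applies between them. *)
Lemma interior_root :
  (P setT < \int[P]_p ((1 - u p / A)%:E)^-1)%E ->
  (P setT < \int[P]_p ((1 - u p / B)%:E)^-1)%E ->
  exists s, [/\ exists2 e, 0 < e & forall p, e <= 1 + s * u p,
    P.-integrable setT (EFin \o (fun p => u p / (1 + s * u p))),
    (\int[P]_p ((u p / (1 + s * u p))%:E) = 0)%E &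
    (\int[P]_p ((1 + s * u p)^-1)%:E = P setT)%E].
Proof.
move=> HA HB.
have mx (C : R) : measurable_fun setT (fun p => 1 - u p / C).
  by apply: measurable_funB => //; exact: measurable_funM.
have xA0 p : 0 <= 1 - u p / A by rewrite subr_ge0 ler_ndivrMr// mul1r.
have xB0 p : 0 <= 1 - u p / B by rewrite subr_ge0 ler_pdivrMr// mul1r.
have [t1 [/andP[t10 t11] H1]] := interior_inv_integral_gt (mx A) xA0 HA.
have [t2 [/andP[t20 t21] H2]] := interior_inv_integral_gt (mx B) xB0 HB.
(* Strictly between [max t1 t2] and [1], so that [- t1 / A] and [- t2 / B] lie inside the open
   interval on which [F] is shown continuous. *)
pose t := (1 + Num.max t1 t2) / 2.
have mt1 : Num.max t1 t2 < 1 by rewrite gt_max t11.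
have lt1 : t < 1 by rewrite /t; lra.
have t1m : t1 <= Num.max t1 t2 by rewrite le_max lexx.
have t2m : t2 <= Num.max t1 t2 by rewrite le_max lexx orbT.
have t1t : t1 < t by rewrite /t; lra.
have t2t : t2 < t by rewrite /t; lra.
have t0 : 0 < t by exact: lt_trans t1t.
have NB0 (r : R) : 0 < r -> - r / B < 0.
  by move=> r0; rewrite mulNr oppr_lt0 divr_gt0.
have NA0 (r : R) : 0 < r -> 0 < - r / A.
  by move=> r0; rewrite mulNr -mulrN -invrN divr_gt0// oppr_gt0.
have s1t : - t / B < - t1 / A < - t / A.
  by rewrite (lt_trans (NB0 _ t0) (NA0 _ t10))/= ltr_nM2r ?invr_lt0// ltrN2.
have s2t : - t / B < - t2 / B < - t / A.
  by rewrite (lt_trans (NB0 _ t20) (NA0 _ t0)) andbT ltr_pM2r ?invr_gt0// ltrN2.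
have itvW (s : R) : - t / B < s < - t / A -> - t / B <= s <= - t / A.
  by move=> /andP[/ltW-> /ltW->].
pose F s := \int[P]_p (u p / (1 + s * u p)).
(* For [s = - r / C], the expression [1 - r + r * (1 - u / C)] is [1 + s * u]. *)
have sF_lt0 (r s : R) C : - t / B <= s <= - t / A -> s = - r / C ->
    (P setT < \int[P]_p ((1 - r + r * (1 - u p / C))^-1)%:E)%E -> s * F s < 0.
  move=> st sE; rewrite (eq_integral (fun p => ((1 + s * u p)^-1)%:E)).
    rewrite (integral_affine_inv lt1 st) -{1}[P setT]fineK ?fin_num_measure//.
    by rewrite lte_fin ltrDl oppr_gt0.
  move=> p _; congr ((_^-1)%:E); rewrite sE mulrBr mulr1 addrA subrK mulNr mulNr.
  by rewrite mulrAC mulrA.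
have F1 : F (- t1 / A) < 0.
  by rewrite -(pmulr_rlt0 _ (NA0 _ t10)) (sF_lt0 t1 _ A (itvW _ s1t)).
have F2 : 0 < F (- t2 / B).
  by rewrite -(nmulr_rlt0 _ (NB0 _ t20)) (sF_lt0 t2 _ B (itvW _ s2t)).
have cF : {in `](- t / B), (- t / A)[%classic, continuous F}.
  apply: (@continuity_under_integral _ _ _ P _ setT measurableT _ _ _ _
    (cst ((B - A) / (1 - t)))).
  - move=> s /=; rewrite in_itv/= => /itvW; exact: integrable_bounded_ratio.
  - apply: aeW => p _ s; rewrite inE /= in_itv/= => /itvW st.
    apply: cvgM; first exact: cvg_cst.
    apply: cvgV.
      by rewrite gt_eqF// (lt_le_trans _ (affine_ge p lt1 st))// subr_gt0.
    apply: cvgD; first exact: cvg_cst.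
    by apply: cvgM; [exact: cvg_id|exact: cvg_cst].
  - exact: finite_measure_integrable_cst.
  - move=> s /=; rewrite in_itv/= => /itvW st; apply: aeW => p _.
    exact: norm_affine_ratio_le.
have [c] : exists2 c, c \in `[(- t2 / B), (- t1 / A)] & F c = 0.
  apply: IVT.
  - by rewrite ltW// (lt_trans (NB0 _ t20) (NA0 _ t10)).
  - apply: continuous_in_subspaceT => s; rewrite inE/= in_itv/= => /andP[s2 s1].
    apply: cF; rewrite inE/= in_itv/=.
    have /andP[tt2 _] := s2t; have /andP[_ tt1] := s1t.
    by rewrite (lt_le_trans tt2 s2) (le_lt_trans s1 tt1).
  - by rewrite ge_min le_max (ltW F1) (ltW F2) !orbT.
rewrite in_itv /= => /andP[c2 c1] Fc.
have ct : - t / B <= c <= - t / A.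
  have /andP[/ltW tt2 _] := s2t; have /andP[_ /ltW tt1] := s1t.
  by rewrite (le_trans tt2 c2) (le_trans c1 tt1).
exists c; split => //.
- exists (1 - t); first by rewrite subr_gt0.
  by move=> p; exact: affine_ge.
- exact: integrable_bounded_ratio ct.
- rewrite -[LHS]fineK; first by congr _%:E.
  by rewrite integrable_fin_num//; exact: integrable_bounded_ratio ct.
- rewrite (integral_affine_inv lt1 ct) -/(F c) Fc mulr0 subr0.
  by rewrite fineK// fin_num_measure.
Qed.
End InteriorRoot.

(** * Maximizers and condensation *)

Section Maximizers.
Local Open Scope ereal_scope.
Context {R : realType} {d : nat}.
Local Notation T := (torus R d).
Local Notation dp := (@torus_lebesgue R d).
Variable omega : T -> R.
Hypothesis momega : measurable_fun setT omega.
Hypothesis omega_ge0 : forall p, (0 <= omega p)%R.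
Hypothesis omega_le1 : forall p, (omega p <= 1)%R.
Implicit Types (munu : R * R) (lam sing : {measure set T -> \bar R}).
Local Notation aff munu := (fun p => munu.1 * omega p + munu.2)%R.
Local Notation RJ munu := (rayleigh_jeans omega munu).

Lemma decomposition_energy lam f sing : lebesgue_decomposition lam f sing ->
  energy omega lam = density_energy omega f + energy omega sing.
Proof.
move=> D; rewrite /energy (decomposition_integral D)//.
exact/measurable_EFinP.
Qed.

Lemma supported_on_energy sing (w0 : R) : (0 <= w0)%R ->
  supported_on sing [set p | omega p = w0] ->
  energy omega sing = w0%:E * mass sing.
Proof.
move=> w00 sS; have mS : measurable [set p | omega p = w0].
  by rewrite -[X in measurable X]setTI; apply: (momega _ (measurable_set1 w0)).
rewrite /energy /mass -integral_cst//; apply: ae_eq_integral => //.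
  exact/measurable_EFinP.
exists (~` [set p | omega p = w0]); split => //; first exact: measurableC.
by move=> p /=; apply: contra_not => ->.
Qed.

(** A multiple of a Dirac mass at one point of [S] realizes the condensate. *)
Lemma decomposition_dirac_exists f (c : R) (p0 : T) (S : set T) :
  measurable_fun setT f -> (forall p, 0 <= f p) -> (0 <= c)%R ->
  measurable S -> dp S = 0 -> S p0 ->
  exists lam sing, [/\ lebesgue_decomposition lam f sing,
    mass sing = c%:E & supported_on sing S].
Proof.
move=> mf f0 c0 mS S0 Sp0.
pose sing : {measure set T -> \bar R} := mscale (NngNum c0) (\d_ p0).
pose fdp : {measure set T -> \bar R} := density_measure dp mf f0.
have singE A : sing A = c%:E * \d_p0 A by [].
have sS : sing (~` S) = 0.
  by rewrite singE diracE memNset ?mule0// => /(_ Sp0).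
exists (measure_add fdp sing), sing; split => //.
- split => //; first by exists S; split.
  by move=> A mA; exact: measure_addE.
- by rewrite /mass singE diracT mule1.
Qed.

(** The feasible [lam0] attains the Gibbs bound, so the maximizers are exactly the equality cases.
    Here [m] and [e] belong to the regular part, [M0] and [E0] to the whole measure. *)
Lemma rayleigh_jeans_maximizers munu (m e M0 E0 : R) :
  rj_with_mass_energy omega m e munu ->
  (munu.1 * E0 + munu.2 * M0 = (2 * pi) ^+ d)%R ->
  (exists lam sing, feasible omega M0 E0 lam /\
    lebesgue_decomposition lam (RJ munu) sing) ->
  (exists lam, maximizer omega M0 E0 lam) /\
  forall lam, maximizer omega M0 E0 lam <->
    feasible omega M0 E0 lam /\
    exists sing, lebesgue_decomposition lam (RJ munu) sing /\
      supported_on sing [set p | aff munu p = 0%R].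
Proof.
move=> [[_ h0] rM rE] munuME [lam0 [sing0 [feas0 D0]]].
have Moo : density_mass (RJ munu) < +oo by rewrite rM ltry.
have null := rayleigh_jeans_null_zeros momega h0 Moo.
have Hmax lam s : feasible omega M0 E0 lam ->
    lebesgue_decomposition lam (RJ munu) s -> maximizer omega M0 E0 lam.
  move=> feas D; split => // lam' feas'.
  rewrite (@entropy_rayleigh_jeans _ _ _ momega omega_ge0 omega_le1 munu h0 null lam s)//.
    exact: (entropy_le momega omega_ge0 omega_le1 h0 null Moo munuME feas').
  by have [-> _] := feas; rewrite ltry.
split; first by exists lam0; exact: Hmax D0.
move=> lam; split => [[feas lammax]|[feas [s [D _]]]]; last exact: Hmax D.
split => //.
apply: (entropy_eq_decomposition momega omega_ge0 omega_le1 h0 null Moo munuME feas).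
rewrite -(@entropy_rayleigh_jeans _ _ _ momega omega_ge0 omega_le1 munu h0 null lam0 sing0)//.
  exact: lammax.
by have [-> _] := feas0; rewrite ltry.
Qed.

(** This serves both condensed regimes, with [w0] an extreme value of [omega] and the affine
    function [c * (omega - w0)]. The equation for [c] is the constraint [munuME], and the missing
    mass [M0 - m] goes to the zeros. *)
Lemma condensation (w0 c m M0 E0 : R) (p0 : T) : omega p0 = w0 ->
  c != 0%R -> (forall p, 0 <= c * omega p + - (c * w0))%R ->
  dp [set p | omega p = w0] = 0 ->
  density_mass (RJ (c, - (c * w0))%R) = m%:E ->
  (c * (E0 - w0 * M0) = (2 * pi) ^+ d)%R -> (m <= M0)%R ->
  [/\ rj_with_mass_energy omega m (E0 - w0 * (M0 - m)) (c, - (c * w0))%R,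
      exists lam, maximizer omega M0 E0 lam &
      forall lam, maximizer omega M0 E0 lam <->
        exists sing,
          [/\ lebesgue_decomposition lam (RJ (c, - (c * w0))%R) sing,
              mass sing = (M0 - m)%:E,
              energy omega sing = (w0 * (M0 - m))%:E &
              supported_on sing [set p | omega p = w0]]].
Proof.
move=> p0w c0 h0 null rM cE mM; set munu := (c, - (c * w0))%R.
have zeros : [set p | aff munu p = 0%R] = [set p | omega p = w0].
  apply/seteqP; split => p /= => [/eqP|->]; last by rewrite subrr.
  by rewrite -mulrBr mulf_eq0 (negbTE c0) subr_eq0 => /eqP.
have w00 : (0 <= w0)%R by rewrite -p0w.
have null' : dp [set p | aff munu p = 0%R] = 0 by rewrite zeros.
have mS : measurable [set p | omega p = w0].
  by rewrite -zeros; exact: measurable_affine_zeros.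
have rj : rj_with_mass_energy omega m (E0 - w0 * (M0 - m)) munu.
  split => //.
    by split => // -[/eqP]; rewrite (negbTE c0).
  have iV : dp.-integrable setT (EFin \o (fun p => (aff munu p)^-1)%R).
    by apply: integrable_affineV => //; rewrite rM ltry.
  rewrite density_energyE//.
  (* Where [h = c * (omega - w0)] is nonzero, [omega / h = 1 / c + w0 / h]. *)
  transitivity (\int[dp]_p (c^-1%:E + w0%:E * ((aff munu p)^-1)%:E)).
    apply: ae_eq_integral => //.
    - apply/measurable_EFinP; apply: measurable_funM => //.
      by apply/measurable_EFinP; exact: measurable_int iV.
    - apply: emeasurable_funD => //; apply: emeasurable_funM => //.
      exact: measurable_int iV.
    - have := ae_gt0 h0 null' (integrable_affine momega omega_ge0 omega_le1 munu).
      apply: filterS => p hp _; rewrite -EFinM -EFinD; congr _%:E.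
      rewrite /= in hp; rewrite /munu /=.
      have hn : (c * omega p - c * w0 != 0)%R by rewrite gt_eqF.
      by apply: (mulIf hn); rewrite mulrDl !divfK// mulrBr !mulKf// subrK.
  rewrite integralD//; [|exact: finite_measure_integrable_cst|exact: integrableZl].
  rewrite integral_cst// [X in _ * X + _]torus_lebesgueT integralZl//.
  (* By [cE], the constant [1 / c] has integral [E0 - w0 * M0]. *)
  rewrite -density_massE// rM -cE -!EFinM -EFinD; congr _%:E.
  by rewrite mulKf//; ring.
have munuME : (munu.1 * E0 + munu.2 * M0 = (2 * pi) ^+ d)%R.
  by rewrite -cE /=; ring.
have Mm0 : (0 <= M0 - m)%R by rewrite subr_ge0.
have [lam0 [s0 [D0 s0M s0S]]] := decomposition_dirac_exists
  (measurable_rayleigh_jeans momega munu) (@rayleigh_jeans_ge0 _ _ _ munu h0)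
  Mm0 mS null p0w.
have feas lam s : lebesgue_decomposition lam (RJ munu) s ->
    mass s = (M0 - m)%:E -> supported_on s [set p | omega p = w0] ->
    feasible omega M0 E0 lam.
  move=> D sM sS; split.
    by rewrite (decomposition_mass D) rM sM -EFinD addrC subrK.
  rewrite (decomposition_energy D) (supported_on_energy w00 sS) sM.
  by have [_ _ ->] := rj; rewrite -EFinM -EFinD subrK.
have [] := rayleigh_jeans_maximizers rj munuME.
  by exists lam0, s0; split => //; exact: feas D0 _ _.
move=> exmax maxP; split => // lam; rewrite maxP zeros; split.
  move=> [[lamM _] [s [D sS]]]; exists s.
  have sM : mass s = (M0 - m)%:E.
    move: lamM; rewrite (decomposition_mass D) rM => lamM.
    by rewrite EFinB -lamM (addeC m%:E) addeK.
  by split => //; rewrite (supported_on_energy w00 sS) sM.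
by move=> [s [D sM _ sS]]; split; [exact: feas D sM sS|exists s].
Qed.

End Maximizers.

(** * Threshold integrals *)

Section Threshold.
Local Open Scope ereal_scope.
Context {disp : measure_display} {T : measurableType disp} {R : realType}.
Variable P : {finite_measure set T -> \bar R}.
Variables (V : R) (x : T -> R).
Hypotheses (V_gt0 : (0 < V)%R) (PT : P setT = V%:E).
Hypotheses (mx : measurable_fun setT x) (x_ge0 : forall p, (0 <= x p)%R).
Hypothesis x_le1 : forall p, (x p <= 1)%R.

(** For [x = omega - a] the quantity [V * fine I^-1] is [alpha - a], and for [x = 1 - omega] it is
    [1 - beta]. *)
Let I := \int[P]_p ((x p)%:E)^-1.

Lemma measurable_inve : measurable_fun setT (fun p => ((x p)%:E)^-1).
Proof.
rewrite (_ : (fun p => _) = fun p => if x p == 0%R then +oo else ((x p)^-1)%:E).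
  apply: measurable_fun_ifT => //; first exact: measurable_fun_eqr.
  by apply/measurable_EFinP; exact: measurableT_comp (@measurable_invr R) mx.
by apply/funext => p; rewrite inver.
Qed.

Lemma integral_inve_scale (y : R) : (0 < y)%R ->
  \int[P]_p ((y * x p)%:E)^-1 = y^-1%:E * I.
Proof.
move=> y0; rewrite /I -ge0_integralZl//.
- apply: eq_integral => p _; rewrite !inver mulf_eq0 (gt_eqF y0)/=.
  case: ifPn => _; first by rewrite gt0_muley// lte_fin invr_gt0.
  by rewrite -EFinM invfM.
- exact: measurable_inve.
- by move=> p _; rewrite inve_ge0 lee_fin.
- by rewrite lee_fin invr_ge0 ltW.
Qed.

(** This follows from [x <= 1] and excludes [I = 0]: the inverse of [I] is the ordinary one or, for
    [I = +oo], zero. *)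
Let V_le_I : V%:E <= I.
Proof.
rewrite -PT -[leLHS]mul1e -integral_cst//; apply: ge0_le_integral => //.
  exact: measurable_inve.
move=> p _; rewrite inver; case: ifPn => [_|xp0]; first by rewrite leey.
by rewrite lee_fin invf_ge1 ?x_le1// lt_def xp0 x_ge0.
Qed.

(** After scaling, the integral is [y * I], so this is [V / I < y] rearranged; for [I = +oo] it is
    infinite. *)
Lemma threshold_lt (y : R) : (0 < y)%R -> (V * fine I^-1 < y)%R ->
  V%:E < \int[P]_p ((y^-1 * x p)%:E)^-1.
Proof.
move=> y0; rewrite integral_inve_scale ?invr_gt0// invrK.
case: I V_le_I => [r| |] //; last by rewrite gt0_muley ?lte_fin// ltry.
rewrite lee_fin => Vr; have r0 := lt_le_trans V_gt0 Vr.
by rewrite inver (gt_eqF r0)/= -EFinM lte_fin ltr_pdivrMr.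
Qed.

(** [I = +oo] would make the product [0]. Hence the integral is finite in the condensed regimes. *)
Lemma threshold_gt0 : (0 < V * fine I^-1)%R ->
  exists2 r, (0 < r)%R & I = r%:E /\ (V * fine I^-1 = V / r)%R.
Proof.
case: I V_le_I => [r| |] //; last by rewrite /= mulr0 ltxx.
rewrite lee_fin => Vr _; have r0 := lt_le_trans V_gt0 Vr.
by exists r => //; rewrite inver (gt_eqF r0).
Qed.

Lemma threshold_ge0 : (0 <= V * fine I^-1)%R.
Proof.
by rewrite mulr_ge0 ?(ltW V_gt0)// fine_ge0// inve_ge0 (le_trans _ V_le_I)// lee_fin ltW.
Qed.

End Threshold.

(** * Existence of the equilibrium between the thresholds *)

Section Interior.
Local Open Scope ereal_scope.
Context {R : realType} {d : nat}.
Local Notation T := (torus R d).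
Local Notation dp := (@torus_lebesgue R d).
Variables (omega : T -> R) (a : R).
Hypothesis momega : measurable_fun setT omega.
Hypothesis omega_gea : forall p, (a <= omega p)%R.
Hypothesis omega_le1 : forall p, (omega p <= 1)%R.

(** [interior_root] at [u = omega - e] yields a profile [1 / k] of mean energy [e], which is then
    rescaled to mass [M0]. *)
Lemma interior_rayleigh_jeans (M0 E0 : R) : (0 < M0)%R -> (0 <= a)%R ->
  (alpha omega a < E0 / M0 < beta omega)%R ->
  exists munu, rj_with_mass_energy omega M0 E0 munu /\
    forall p, (0 < munu.1 * omega p + munu.2)%R.
Proof.
move=> M00 a0; set e := (E0 / M0)%R => /andP[ae eb].
have V0 : (0 < (2 * pi) ^+ d :> R)%R by rewrite exprn_gt0// mulr_gt0// pi_gt0.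
have PT := @torus_lebesgueT R d.
have ma : measurable_fun setT (fun p => omega p - a)%R by exact: measurable_funB.
have m1 : measurable_fun setT (fun p => 1 - omega p)%R by exact: measurable_funB.
have a_ge p : (0 <= omega p - a)%R by rewrite subr_ge0.
have a_le p : (omega p - a <= 1)%R by have := omega_le1 p; lra.
have b_ge p : (0 <= 1 - omega p)%R by rewrite subr_ge0.
have b_le p : (1 - omega p <= 1)%R by have := omega_gea p; lra.
have ae0 : (a < e)%R.
  by apply: le_lt_trans ae; rewrite /alpha lerDl (threshold_ge0 V0 PT).
have eb0 : (e < 1)%R.
  by apply: (lt_le_trans eb); rewrite /beta gerDl oppr_le0 (threshold_ge0 V0 PT).
have [s [[eps eps0 k_ge] iu u0 k1]] :
  exists s, [/\ exists2 e', (0 < e')%R & forall p, (e' <= 1 + s * (omega p - e))%R,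
    dp.-integrable setT (EFin \o (fun p => (omega p - e) / (1 + s * (omega p - e)))%R),
    \int[dp]_p ((omega p - e) / (1 + s * (omega p - e)))%:E = 0 &
    \int[dp]_p ((1 + s * (omega p - e))^-1)%:E = dp setT].
  apply: (@interior_root _ _ _ dp (a - e) (1 - e) (fun p => omega p - e)%R) => //.
  - by rewrite subr_lt0.
  - by rewrite subr_gt0.
  - exact: measurable_funB.
  - by move=> p; rewrite lerB.
  - by move=> p; rewrite lerB.
  (* Since [1 - (omega - e) / (a - e) = (omega - a) / (e - a)], this condition is [alpha < e]; the
     next one is [e < beta] in the same way. *)
  - rewrite [ltLHS]PT (eq_integral (fun p => (((e - a)^-1 * (omega p - a))%:E)^-1)).
      apply: (threshold_lt V0 PT) => //; first by rewrite subr_gt0.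
      by rewrite ltrBrDl.
    move=> p _; congr ((_%:E)^-1); field.
    by rewrite !subr_eq0 (lt_eqF ae0) (gt_eqF ae0).
  - rewrite [ltLHS]PT (eq_integral (fun p => (((1 - e)^-1 * (1 - omega p))%:E)^-1)).
      apply: (threshold_lt V0 PT) => //; first by rewrite subr_gt0.
      by rewrite ltrBrDl -ltrBrDr.
    move=> p _; congr ((_%:E)^-1); field.
    by rewrite subr_eq0 (gt_eqF eb0).
(* As [1 / k] has integral [(2 * pi) ^+ d], dividing by this [c] gives mass [M0]. *)
pose c : R := ((2 * pi) ^+ d / M0)%R.
have c0 : (0 < c)%R by rewrite divr_gt0.
pose munu := (c * s, c * (1 - s * e))%R.
have hE p : (munu.1 * omega p + munu.2 = c * (1 + s * (omega p - e)))%R.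
  by rewrite /=; ring.
have k0 p : (0 < 1 + s * (omega p - e))%R by exact: lt_le_trans (k_ge p).
have h_gt0 p : (0 < munu.1 * omega p + munu.2)%R by rewrite hE mulr_gt0.
have h0 p : (0 <= munu.1 * omega p + munu.2)%R by rewrite ltW.
have null : dp [set p | munu.1 * omega p + munu.2 = 0]%R = 0.
  rewrite (_ : [set p | _] = set0)//.
  by apply/seteqP; split => p //= hp; have := h_gt0 p; rewrite /= hp ltxx.
have mk : measurable_fun setT (fun p => ((1 + s * (omega p - e))^-1)%:E).
  apply/measurable_EFinP; apply: measurableT_comp (@measurable_invr R) _.
  apply: measurable_funD => //; apply: measurable_funM => //.
  exact: measurable_funB.
have ik : dp.-integrable setT (fun p => ((1 + s * (omega p - e))^-1)%:E).
  apply/integrableP; split => //.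
  under eq_integral do rewrite gee0_abs ?lee_fin ?invr_ge0 ?(ltW (k0 _))//.
  by rewrite k1 [ltLHS]PT ltry.
have cV : (c^-1 * (2 * pi) ^+ d = M0)%R by rewrite /c invf_div divfK// gt_eqF.
exists munu; split => //; split.
- split => // m0; have := h_gt0 point; rewrite m0 /= mul0r add0r ltxx//.
- rewrite density_massE//.
  transitivity (\int[dp]_p (c^-1%:E * ((1 + s * (omega p - e))^-1)%:E)).
    by apply: eq_integral => p _; rewrite hE invfM EFinM.
  by rewrite integralZl// k1 [X in _ * X]PT -EFinM cV.
- rewrite density_energyE//.
  (* [omega / k = (omega - e) / k + e / k], and the first term integrates to zero. *)
  transitivity (\int[dp]_p
      (c^-1%:E * ((omega p - e) / (1 + s * (omega p - e)))%:E +
       (c^-1 * e)%:E * ((1 + s * (omega p - e))^-1)%:E)).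
    apply: eq_integral => p _; rewrite hE invfM -!EFinM -EFinD; congr _%:E.
    by ring.
  rewrite integralD//; [|exact: integrableZl..].
  rewrite !integralZl// u0 mule0 add0e k1 [X in _ * X]PT -EFinM; congr _%:E.
  by rewrite mulrAC cV /e mulrC divfK// gt_eqF.
Qed.

End Interior.

(** In the third regime the condensate sits where [omega = a]: a regular part of energy ratio
    [alpha] together with mass at [omega = 1] would have ratio at least [alpha]. Solving
    [m + s = M0] and [alpha * m + a * s = E0] gives the stated masses [m] and [s] of the two
    parts. *)
Theorem theorem1p1 (R : realType) (d : nat) (omega : torus R d -> R) (a : R)
    (omega_cont : continuous omega)
    (a_ge0 : 0 <= a)
    (omega_ge : forall p, a <= omega p) (omega_min : exists p, omega p = a)
    (omega_le : forall p, omega p <= 1) (omega_max : exists p, omega p = 1)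
    (min_null : torus_lebesgue [set p | omega p = a] = 0%E)
    (max_null : torus_lebesgue [set p | omega p = 1] = 0%E)
    (M0 E0 : R) (M0_gt0 : 0 < M0) :
  [/\ alpha omega a < E0 / M0 < beta omega ->
      exists munu : R * R,
        [/\ unique (rj_with_mass_energy omega M0 E0) munu,
            exists lam, maximizer omega M0 E0 lam &
            forall lam, maximizer omega M0 E0 lam <->
              has_density lam (rayleigh_jeans omega munu)],
      beta omega <= E0 / M0 < 1 ->
      exists munu : R * R,
        [/\ unique (rj_with_mass_energy omega
               ((M0 - E0) / (1 - beta omega))
               (beta omega * ((M0 - E0) / (1 - beta omega)))) munu,
            exists lam, maximizer omega M0 E0 lam &
            forall lam, maximizer omega M0 E0 lam <->
              exists sing,
                [/\ lebesgue_decomposition lam (rayleigh_jeans omega munu) sing,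
                    mass sing =
                      (1 / (1 - beta omega) * (E0 - beta omega * M0))%:E &
                    supported_on sing [set p | omega p = 1]]] &
      a < E0 / M0 <= alpha omega a ->
      exists munu : R * R,
        [/\ unique (rj_with_mass_energy omega
               ((E0 - a * M0) / (alpha omega a - a))
               (alpha omega a * ((E0 - a * M0) / (alpha omega a - a)))) munu,
            exists lam, maximizer omega M0 E0 lam &
            forall lam, maximizer omega M0 E0 lam <->
              exists sing,
                [/\ lebesgue_decomposition lam (rayleigh_jeans omega munu) sing,
                    mass sing =
                      (1 / (alpha omega a - a) * (alpha omega a * M0 - E0))%:E,
                    energy omega sing =
                      (a * (1 / (alpha omega a - a)
                            * (alpha omega a * M0 - E0)))%:E &
                    supported_on sing [set p | omega p = a]]]].
Proof.
have momega := continuous_torus_measurable omega_cont.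
have omega_ge0 p : 0 <= omega p by rewrite (le_trans a_ge0).
have V0 : 0 < (2 * pi) ^+ d :> R by rewrite exprn_gt0// mulr_gt0// pi_gt0.
have PT := @torus_lebesgueT R d.
have [pa pa_a] := omega_min; have [p1 p1_1] := omega_max.
(* If [a = 1], the null set [omega = 1] would be the whole torus. *)
have a1 : a < 1.
  rewrite lt_neqAle -{2}p1_1 omega_ge andbT; apply/eqP => a1.
  have : torus_lebesgue [set p | omega p = 1] = torus_lebesgue [set: torus R d].
    congr torus_lebesgue; apply/seteqP; split => // p _ /=.
    by apply/eqP; rewrite eq_le omega_le -a1 omega_ge.
  by rewrite max_null PT => -[] e; move: V0; rewrite -e ltxx.
have omega_ne : exists p q, omega p != omega q.
  by exists pa, p1; rewrite pa_a p1_1 lt_eqF.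
have uniq munu M E : rj_with_mass_energy omega M E munu ->
    unique (rj_with_mass_energy omega M E) munu.
  move=> rj; split => // munu' rj'.
  exact: (rayleigh_jeans_unique momega omega_ge0 omega_le omega_cont omega_ne rj rj').
have ma : measurable_fun setT (fun p => omega p - a) by exact: measurable_funB.
have m1 : measurable_fun setT (fun p => 1 - omega p) by exact: measurable_funB.
have a_ge p : 0 <= omega p - a by rewrite subr_ge0.
have a_le p : omega p - a <= 1 by have := omega_le p; lra.
have b_ge p : 0 <= 1 - omega p by rewrite subr_ge0.
have b_le p : 1 - omega p <= 1 by have := omega_ge p; lra.
split.
- move=> aEb.
  have [munu [rj h_gt0]] := interior_rayleigh_jeans momega omega_ge omega_le M0_gt0 a_ge0 aEb.
  have zeros : [set p | munu.1 * omega p + munu.2 = 0] = set0.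
    by apply/seteqP; split => p //= hp; have := h_gt0 p; rewrite hp ltxx.
  exists munu.
  have RJ0 p : (0 <= rayleigh_jeans omega munu p)%E.
    exact: rayleigh_jeans_ge0 (fun p => ltW (h_gt0 p)) p.
  have mRJ := measurable_rayleigh_jeans momega munu.
  pose zero : {measure set (torus R d) -> \bar R} := mzero.
  have dens lam : has_density lam (rayleigh_jeans omega munu) ->
      lebesgue_decomposition lam (rayleigh_jeans omega munu) zero.
    move=> lamRJ; split => //; first by exists set0; split.
    by move=> A mA; rewrite lamRJ// adde0.
  have feas lam : has_density lam (rayleigh_jeans omega munu) ->
      feasible omega M0 E0 lam.
    move=> /dens D; have [_ rM rE] := rj; split.
      by rewrite (decomposition_mass D) rM adde0.
    rewrite (decomposition_energy momega omega_ge0 D) rE /energy.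
    by rewrite integral_measure_zero adde0.
  pose lam0 : {measure set (torus R d) -> \bar R} :=
    density_measure torus_lebesgue mRJ RJ0.
  have lam0P : has_density lam0 (rayleigh_jeans omega munu) by [].
  have [] := rayleigh_jeans_maximizers momega omega_ge0 omega_le rj
    (rayleigh_jeans_relation momega omega_ge0 omega_le rj).
    by exists lam0, zero; split; [exact: feas|exact: dens].
  move=> exmax maxP; split => //; first exact: uniq.
  (* The affine function has no zeros, so a singular part supported on them vanishes. *)
  move=> lam; rewrite maxP zeros; split => [[_ [s [[_ _ _ lamE] sS]]] A mA|lamRJ].
    rewrite lamE// (_ : s A = 0%E) ?adde0//.
    by apply: (subset_measure0 _ _ _ sS) => //; rewrite setC0.
  by split; [exact: feas|exists zero; split; [exact: dens|]].
- move=> /andP[bE E1].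
  have E0M0 : E0 < M0 by move: E1; rewrite ltr_pdivrMr// mul1r.
  have bM0 : beta omega * M0 <= E0 by move: bE; rewrite ler_pdivlMr.
  have b0 : 0 < 1 - beta omega by rewrite subr_gt0 (le_lt_trans bE E1).
  have bthr : 1 - beta omega =
      (2 * pi) ^+ d * fine (\int[torus_lebesgue]_p ((1 - omega p)%:E)^-1)^-1%E.
    by rewrite /beta opprB addrC subrK.
  (* Because [beta < 1], the integral has a finite value [r] and [1 - beta = (2 * pi) ^+ d / r]. *)
  have [|r r0 [Ir thr]] := threshold_gt0 V0 PT m1 b_ge b_le.
    by rewrite -bthr.
  rewrite -bthr in thr.
  pose m := (M0 - E0) / (1 - beta omega).
  (* The value forced by [c * (E0 - w0 * M0) = (2 * pi) ^+ d] at [w0 = 1]; it is negative, so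
     [c * (omega - 1)] is nonnegative. *)
  pose c := (2 * pi) ^+ d / (E0 - M0) : R.
  have c0 : c < 0 by rewrite /c pmulr_rlt0// invr_lt0 subr_lt0.
  have [|||||rj exmax maxP] := @condensation _ _ _ momega omega_ge0 omega_le
      1 c m M0 E0 p1 p1_1 _ _ max_null.
  - by rewrite lt_eqF.
  - by move=> p; rewrite mulr1 -{2}[c]mulr1 -mulrBr nmulr_rge0// subr_le0.
  - transitivity (\int[torus_lebesgue]_p (((- c) * (1 - omega p))%:E)^-1)%E.
      apply: eq_integral => p _; rewrite /rayleigh_jeans/=.
      by congr ((_%:E)^-1)%E; ring.
    rewrite (integral_inve_scale _ m1 b_ge) ?oppr_gt0// Ir -EFinM; congr _%:E.
    rewrite /m thr /c; field.
    by rewrite (gt_eqF r0) (gt_eqF V0) ?subr_eq0 (lt_eqF E0M0) ?(gt_eqF E0M0).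
  - by rewrite mul1r /c divfK// lt_eqF// subr_lt0.
  - by rewrite /m ler_pdivrMr// mulrBr mulr1 lerD2l lerN2 mulrC.
  have mE : E0 - 1 * (M0 - m) = beta omega * m.
    by rewrite /m; field; rewrite gt_eqF.
  have mM : M0 - m = 1 / (1 - beta omega) * (E0 - beta omega * M0).
    by rewrite /m; field; rewrite gt_eqF.
  exists (c, - (c * 1)); split => //; first by apply: uniq; rewrite -mE.
  move=> lam; rewrite maxP; split.
    by move=> [s [D sM _ sS]]; exists s; split => //; rewrite sM mM.
  move=> [s [D sM sS]]; exists s; split => //; first by rewrite sM mM.
  by rewrite (supported_on_energy momega ler01 sS) sM mM -EFinM.
- move=> /andP[aE Ea].
  have E0M0 : a * M0 < E0 by move: aE; rewrite ltr_pdivlMr.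
  have aM0 : E0 <= alpha omega a * M0 by move: Ea; rewrite ler_pdivrMr.
  have b0 : 0 < alpha omega a - a by rewrite subr_gt0 (lt_le_trans aE Ea).
  have bthr : alpha omega a - a =
      (2 * pi) ^+ d * fine (\int[torus_lebesgue]_p ((omega p - a)%:E)^-1)^-1%E.
    by rewrite /alpha addrC addKr.
  have [|r r0 [Ir thr]] := threshold_gt0 V0 PT ma a_ge a_le.
    by rewrite -bthr.
  rewrite -bthr in thr.
  pose m := (E0 - a * M0) / (alpha omega a - a).
  (* The same equation at [w0 = a]; here [c] is positive. *)
  pose c := (2 * pi) ^+ d / (E0 - a * M0) : R.
  have c0 : 0 < c by rewrite /c divr_gt0// subr_gt0.
  have [|||||rj exmax maxP] := @condensation _ _ _ momega omega_ge0 omega_le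
      a c m M0 E0 pa pa_a _ _ min_null.
  - by rewrite gt_eqF.
  - by move=> p; rewrite -mulrBr mulr_ge0// ltW.
  - transitivity (\int[torus_lebesgue]_p ((c * (omega p - a))%:E)^-1)%E.
      apply: eq_integral => p _; rewrite /rayleigh_jeans/=.
      by congr ((_%:E)^-1)%E; ring.
    rewrite (integral_inve_scale _ ma a_ge)// Ir -EFinM; congr _%:E.
    rewrite /m thr /c; field.
    by rewrite (gt_eqF r0) (gt_eqF V0) subr_eq0 (gt_eqF E0M0).
  - by rewrite /c divfK// gt_eqF// subr_gt0.
  - by rewrite /m ler_pdivrMr// mulrBr (mulrC M0 a) lerD2r mulrC.
  have mE : E0 - a * (M0 - m) = alpha omega a * m.
    by rewrite /m; field; rewrite gt_eqF.
  have mM : M0 - m = 1 / (alpha omega a - a) * (alpha omega a * M0 - E0).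
    by rewrite /m; field; rewrite gt_eqF.
  exists (c, - (c * a)); split => //; first by apply: uniq; rewrite -mE.
  by move=> lam; rewrite maxP mM.
Qed.
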